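(* Let $V=V_{\mathrm{ev}}$ or $V=V_{\mathrm{od}}$, and let $\xi_1=(\delta e_1,\delta f_1)$ and $\xi_2=(\delta e_2,\delta f_2)$ be two orthonormal tangent vectors to the Stiefel manifold $\mathbf{St}(2,V)$ at a point $(e,f)$. Then the sectional curvature of $\mathbf{St}(2,V)$ in the plane spanned by $\xi_1,\xi_2$ is \begin{align*} k^{\mathbf{St}(2,V)}_{\mathrm{span}(\xi_1,\xi_2)} &= \|\delta e_1\|^2\|\delta e_2\|^2+\|\delta f_1\|^2\|\delta f_2\|^2+2\langle\delta e_1,\delta f_1\rangle\langle\delta e_2,\delta f_2\rangle\\ &\quad-\langle\delta e_1,\delta e_2\rangle^2-\langle\delta f_1,\delta f_2\rangle^2-\tfrac12\big(\langle\delta e_1,\delta f_2\rangle+\langle\delta f_1,\delta e_2\rangle\big)^2\\ &=\tfrac12\big\|\delta e_1\otimes\delta e_2-\delta e_2\otimes\delta e_1+\delta f_1\otimes\delta f_2-\delta f_2\otimes\delta f_1\big\|^2\\ &\quad-\tfrac12\big(\langle\delta e_1,\delta f_2\rangle-\langle\delta e_2,\delta f_1\rangle\big)^2 . \end{align*}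
   Context: $V_{\mathrm{ev}}$ is the space of $C^\infty$ functions $f:\mathbb R\to\mathbb R$ with $f(\theta+2\pi)=f(\theta)$; $V_{\mathrm{od}}$ is the space of $C^\infty$ functions $f:\mathbb R\to\mathbb R$ with $f(\theta+2\pi)=-f(\theta)$. Both carry the (weak) inner product $\langle f,g\rangle=\int_0^{2\pi}f(x)g(x)\,dx$. $\mathbf{St}(2,V)$ is the manifold of orthonormal pairs $(e,f)\in V\times V$, a codimension 3 submanifold of $V^2$, with the Riemannian metric induced from $V^2$: $\langle\xi_1,\xi_2\rangle=\langle\delta e_1,\delta e_2\rangle+\langle\delta f_1,\delta f_2\rangle$. Its tangent space at $(e,f)$ consists of pairs $(\delta e,\delta f)\in V^2$ with $\langle e,\delta e\rangle=\langle f,\delta f\rangle=\langle e,\delta f\rangle+\langle f,\delta e\rangle=0$. The norm on $V\otimes V$ is the Hilbert–Schmidt norm, determined by $\langle a\otimes b,a'\otimes b'\rangle=\langle a,a'\rangle\langle b,b'\rangle$. *)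

(* Defs.v *)
From HB Require Import structures.
From mathcomp Require Import all_boot all_order all_algebra.
From mathcomp Require Import all_classical all_reals all_analysis.

Set Implicit Arguments.
Unset Strict Implicit.
Unset Printing Implicit Defensive.

Import Order.TTheory GRing.Theory Num.Theory.
Import numFieldNormedType.Exports.

Local Open Scope classical_set_scope.
Local Open Scope ring_scope.
Local Open Scope convex_scope.

Definition smooth1 (R : realType) (f : R -> R) : Prop :=
  forall (n : nat) (x : R), derivable (derive1n n f) x 1.

(* V R false is the even space V_ev (2 pi-periodic functions), V R true the odd
   space V_od (2 pi-antiperiodic functions). *)
Definition Vpred (R : realType) (b : bool) : {pred R -> R} :=
  [pred f : R -> R |
    `[< smooth1 f /\ forall t, f (t + 2 * pi) = (-1) ^+ b * f t >]].
Arguments Vpred : clear implicits.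

Record V (R : realType) (b : bool) := MkV {
  Vfun :> R -> R;
  _ : Vfun \in Vpred R b
}.

HB.instance Definition _ (R : realType) (b : bool) := [isSub for @Vfun R b].
HB.instance Definition _ (R : realType) (b : bool) := [Choice of V R b by <:].

Section smooth1_theory.
Variable R : realType.
Implicit Types f g : R -> R.

Lemma derive1n_linear (a : R) f g (n : nat) : smooth1 f -> smooth1 g ->
  derive1n n (a *: f + g) = a *: derive1n n f + derive1n n g.
Proof.
move=> sf sg; elim: n => [//|n IH]; apply/funext => x.
rewrite derive1nS IH derive1E deriveD//; last exact: derivableZ.
by rewrite deriveZ// !derive1nS -!derive1E.
Qed.

Lemma smooth1_linear (a : R) f g : smooth1 f -> smooth1 g ->
  smooth1 (a *: f + g).
Proof.
move=> sf sg n x; rewrite derive1n_linear//.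
by apply: derivableD => //; exact: derivableZ.
Qed.

Lemma derive1n_cst0 (n : nat) : derive1n n (0 : R -> R) = 0.
Proof.
elim: n => // n IH; apply/funext => x.
by rewrite derive1nS IH derive1E -[0]/(cst 0) derive_cst.
Qed.

Lemma smooth1_0 : smooth1 (0 : R -> R).
Proof. move=> n x; rewrite derive1n_cst0; exact: (@derivable_cst _ _ _ 0). Qed.

Lemma Vpred_submod_closed (b : bool) : submod_closed (Vpred R b).
Proof.
split=> [|a f g].
  by apply/asboolP; split=> [|t]; [exact: smooth1_0|rewrite mulr0].
move=> /asboolP[sf pf] /asboolP[sg pg]; apply/asboolP; split=> [|t]; first exact: smooth1_linear.
rewrite -[LHS]/(a * f (t + 2 * pi) + g (t + 2 * pi)) pf pg.
by rewrite mulrDr mulrCA.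
Qed.

HB.instance Definition _ (b : bool) :=
  GRing.isSubmodClosed.Build _ _ (Vpred R b) (Vpred_submod_closed b).

HB.instance Definition _ (b : bool) := [SubChoice_isSubLmodule of V R b by <:].

End smooth1_theory.

Section V_topology.
Variables (R : realType) (b : bool).
Local Notation V := (V R b).
Implicit Types (f g h : V) (n N : nat) (e : R).

Lemma V_smooth f : smooth1 f.
Proof. by case: f => f /= /asboolP[]. Qed.

Lemma V_period f t : f (t + 2 * pi) = (-1) ^+ b * f t.
Proof. by case: f => f /= /asboolP[_]. Qed.


(* V carries its Frechet topology: uniform convergence of every derivative over
   one period. *)
Definition Vclose N e f g : Prop :=
  forall n t, (n <= N)%N -> 0 <= t <= 2 * pi ->
    `|derive1n n f t - derive1n n g t| < e.

Lemma Vclose_le N N' e e' f g : (N' <= N)%N -> e <= e' ->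
  Vclose N e f g -> Vclose N' e' f g.
Proof.
move=> NN ee H n t nN t2; apply: lt_le_trans ee; apply: H => //.
exact: leq_trans NN.
Qed.

Definition Ventourage : set_system (V * V) :=
  [set P | exists N, exists2 e, 0 < e & forall f g, Vclose N e f g -> P (f, g)].

Lemma Ventourage_filter : Filter Ventourage.
Proof.
split; first by exists 0, 1.
- move=> P Q [N [e e0 HP]] [M [d d0 HQ]].
  exists (maxn N M), (Num.min e d); first by rewrite lt_min e0.
  move=> f g H; split; [apply: HP|apply: HQ]; apply: Vclose_le H.
  + exact: leq_maxl.
  + by rewrite ge_min lexx.
  + exact: leq_maxr.
  + by rewrite ge_min lexx orbT.
- move=> P Q PQ [N [e e0 HP]]; exists N, e => // f g /HP; exact: PQ.
Qed.

Lemma Ventourage_diagonal A : Ventourage A -> (diagonal `<=` A)%classic.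
Proof.
move=> [N [e e0 HA]] [f g]; rewrite /diagonal/= => <-; apply: HA => n t _ _.
by rewrite subrr normr0.
Qed.

Lemma Ventourage_inv A : Ventourage A -> Ventourage (A^-1)%relation.
Proof.
move=> [N [e e0 HA]]; exists N, e => // f g H; apply: HA => n t nN t2.
by rewrite distrC; exact: H.
Qed.

Lemma Ventourage_split_ex A : Ventourage A ->
  exists2 B, Ventourage B & (B \; B `<=` A)%relation.
Proof.
move=> [N [e e0 HA]]; exists [set fg | Vclose N (e / 2) fg.1 fg.2].
  by exists N, (e / 2) => //; rewrite divr_gt0.
move=> [f g] [h /= fh hg]; apply: HA => n t nN t2.
rewrite (splitr e) -(subrKA (derive1n n h t)).
by rewrite (le_lt_trans (ler_normD _ _))// ltrD//; [exact: fh|exact: hg].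
Qed.

HB.instance Definition _ := isUniform.Build V
  Ventourage_filter Ventourage_diagonal Ventourage_inv Ventourage_split_ex.

Lemma V_nbhsP f (A : set V) : nbhs f A <->
  exists N, exists2 e, 0 < e & forall g, Vclose N e f g -> A g.
Proof.
rewrite -nbhs_entourageE; split.
  move=> [B [N [e e0 HB]] BA]; exists N, e => // g fg.
  by apply: BA; apply/xsectionP; exact: HB.
move=> [N [e e0 HA]]; exists [set fg | Vclose N e fg.1 fg.2].
  by exists N, e.
by move=> g /xsectionP /= /HA.
Qed.

Lemma V_derive1nD f g n t :
  derive1n n (f + g : V) t = derive1n n f t + derive1n n g t.
Proof.
rewrite [X in derive1n n X](_ : _ = 1 *: (f : R -> R) + (g : R -> R)).
  by rewrite derive1n_linear ?scale1r//; exact: V_smooth.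
by rewrite scale1r.
Qed.

Lemma V_derive1nZ (a : R) f n t :
  derive1n n (a *: f : V) t = a * derive1n n f t.
Proof.
rewrite [X in derive1n n X](_ : _ = a *: (f : R -> R) + (0 : R -> R)).
  rewrite derive1n_linear ?derive1n_cst0 ?addr0//; first exact: V_smooth.
  exact: smooth1_0.
by rewrite addr0.
Qed.

Lemma V_continuous f n : continuous (derive1n n f).
Proof.
by move=> x; apply/differentiable_continuous/derivable1_diffP; exact: V_smooth.
Qed.

Lemma V_bounded f N : exists2 M, 0 < M & forall n t, (n <= N)%N ->
  0 <= t <= 2 * pi -> `|derive1n n f t| <= M.
Proof.
have bnd n : exists2 M, 0 < M & forall t, 0 <= t <= 2 * pi ->
    `|derive1n n f t| <= M.
  have pi2 : 0 <= 2 * pi :> R by rewrite mulr_ge0// pi_ge0.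
  have cf : {within `[0, 2 * pi], continuous (fun t => `|derive1n n f t|)}.
    apply: continuous_subspaceT => x.
    by apply: continuous_comp; [exact: V_continuous|exact: norm_continuous].
  have [c _ Hc] := EVT_max pi2 cf.
  exists (`|derive1n n f c| + 1); first by rewrite ltr_wpDl.
  by move=> t t2; rewrite (le_trans (Hc t _))// lerDl.
elim: N => [|N [M M0 HM]].
  have [M M0 HM] := bnd 0%N.
  by exists M => // n t; rewrite leqn0 => /eqP ->; exact: HM.
have [K K0 HK] := bnd N.+1.
exists (Num.max M K); first by rewrite lt_max M0.
move=> n t; rewrite leq_eqVlt => /predU1P[->|nN] t2.
  by rewrite le_max HK// orbT.
by rewrite le_max HM.
Qed.

Lemma V_add_continuous : continuous (fun z : V * V => z.1 + z.2).
Proof.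
move=> [f g] A /V_nbhsP[N [e e0 HA]].
exists ([set h | Vclose N (e / 2) f h], [set h | Vclose N (e / 2) g h]) => /=.
  by split; apply/V_nbhsP; exists N, (e / 2) => //; rewrite divr_gt0.
move=> [f' g'] [/= ff gg]; apply: HA => n t nN t2.
rewrite !V_derive1nD opprD addrACA (splitr e).
by rewrite (le_lt_trans (ler_normD _ _))// ltrD//; [exact: ff|exact: gg].
Qed.

Lemma V_scale_continuous : continuous (fun z : R^o * V => z.1 *: z.2).
Proof.
move=> [a f] A /V_nbhsP[N [e e0 HA]].
have [M M0 HM] := V_bounded f N.
pose K := `|a| + 1.
have K0 : 0 < K by rewrite ltr_wpDl.
pose d := Num.min 1 (e / 2 / M).
have d0 : 0 < d by rewrite lt_min ltr01 !divr_gt0.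
exists ([set x : R^o | `|a - x| < d], [set h | Vclose N (e / 2 / K) f h]) => /=.
  split; last by apply/V_nbhsP; exists N, (e / 2 / K) => //; rewrite !divr_gt0.
  by exists d.
move=> [x g] [/= ax fg]; apply: HA => n t nN t2.
rewrite !V_derive1nZ.
have -> : a * derive1n n f t - x * derive1n n g t =
  (a - x) * derive1n n f t + x * (derive1n n f t - derive1n n g t).
  by rewrite mulrBl mulrBr addrA subrK.
rewrite (splitr e) (le_lt_trans (ler_normD _ _))// ltr_leD// !normrM.
  rewrite (le_lt_trans (ler_wpM2l _ (HM _ _ nN t2)))//.
  by rewrite -ltr_pdivlMr//; apply: lt_le_trans ax _; rewrite ge_min lexx orbT.
have xK : `|x| <= K.
  rewrite -[x](subrK a) addrC (le_trans (ler_normD _ _))// lerD2l distrC.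
  by rewrite (le_trans (ltW ax))// ge_min lexx.
rewrite (le_trans (ler_wpM2r _ xK))// mulrC -ler_pdivlMr//.
exact/ltW/fg.
Qed.

Lemma V_locally_convex : exists2 B : set_system V,
  (forall U, U \in B -> convex_set U) & basis B.
Proof.
exists [set U : set V | open U /\ convex_set U].
  by move=> U /[!inE] -[].
split=> [U []//|f A /V_nbhsP[N [e e0 HA]]].
exists [set g : V | exists2 d, d < e & forall n t, (n <= N)%N ->
    0 <= t <= 2 * pi -> `|derive1n n f t - derive1n n g t| <= d]; last first.
  move=> g [d de H]; apply: HA => n t nN t2.
  exact: le_lt_trans (H _ _ nN t2) de.
split; last by exists 0 => // n t _ _; rewrite subrr normr0.
split.
  rewrite openE => g [d de H]; apply/V_nbhsP.
  exists N, ((e - d) / 2); first by rewrite divr_gt0// subr_gt0.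
  move=> h gh; exists (d + (e - d) / 2).
    by rewrite -ltrBrDl ltr_pdivrMr// ltr_pMr ?subr_gt0// ltr1n.
  move=> n t nN t2; rewrite -(subrKA (derive1n n g t)).
  by rewrite (le_trans (ler_normD _ _))// lerD ?H//; exact/ltW/gh.
move=> g h l /[!inE] -[d de Hg] [d' de' Hh].
exists (Num.max d d'); first by rewrite gt_max de.
move=> n t nN t2.
rewrite -[g <| l |> h]/((l%:num *: (g : V) + (1 - l%:num) *: (h : V)) : V).
rewrite V_derive1nD !V_derive1nZ.
have a0 : 0 <= l%:num by [].
have a1 : 0 <= 1 - l%:num by rewrite subr_ge0.
set a := l%:num in a0 a1 *.
have split1 x : x = a * x + (1 - a) * x by rewrite -mulrDl subrKC mul1r.
rewrite [X in `|X - _|]split1 opprD addrACA -!mulrBr.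
rewrite (le_trans (ler_normD _ _))// !normrM (ger0_norm a0) (ger0_norm a1).
rewrite [leRHS]split1; apply: lerD.
  by rewrite ler_wpM2l// le_max Hg.
by rewrite ler_wpM2l// le_max Hh// orbT.
Qed.

HB.instance Definition _ :=
  PreTopologicalNmodule_isTopologicalNmodule.Build V V_add_continuous.
HB.instance Definition _ :=
  TopologicalNmodule_isTopologicalLmodule.Build R V V_scale_continuous.
HB.instance Definition _ := Uniform_isTvs.Build R V V_locally_convex.

End V_topology.

Section Frechet_calculus.
Variable R : realType.

Definition is_gateaux (E F : tvsType R) (f : E -> F) (p v : E) (l : F) : Prop :=
  (fun h : R => h^-1 *: (f (p + h *: v) - f p)) @ 0^' --> l.

(* Directional derivative; the value 0 is a placeholder when it does not
   exist. *)
Definition gateaux (E F : tvsType R) (f : E -> F) (p v : E) : F :=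
  xget 0 [set l | is_gateaux f p v l].

(* Smoothness in the sense of Michal-Bastiani (Hamilton): f is C^(k+1) if it is
   continuous, has all directional derivatives, and (p, v) |-> D_v f (p) is C^k
   on E * E. *)
Fixpoint Ck (k : nat) : forall E F : tvsType R, (E -> F) -> Prop :=
  match k with
  | 0%N => fun E F f => continuous f
  | k'.+1 => fun E F f => [/\ continuous f,
      forall p v, exists l, is_gateaux f p v l &
      Ck k' (fun pv : (E * E)%type => gateaux f pv.1 pv.2)]
  end.

Definition smooth (E F : tvsType R) (f : E -> F) : Prop := forall k, Ck k f.

End Frechet_calculus.

Section stiefel.
Variables (R : realType) (b : bool).
Local Notation V := (V R b).
Local Notation V2 := (V * V)%type.
Implicit Types (p xi eta : V2) (X Y Z : V2 -> V2).

Definition inner (f g : V) : R :=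
  \int[lebesgue_measure]_(x in `[0, 2 * pi]) (f x * g x).

Definition inner2 xi eta : R := inner xi.1 eta.1 + inner xi.2 eta.2.

Definition stiefel : set V2 :=
  [set p | [/\ inner p.1 p.1 = 1, inner p.2 p.2 = 1 & inner p.1 p.2 = 0]].

Definition tangent p : set V2 :=
  [set xi | [/\ inner p.1 xi.1 = 0, inner p.2 xi.2 = 0 &
                inner p.1 xi.2 + inner p.2 xi.1 = 0]].

(* Smooth vector fields and smooth functions on St(2,V) are represented by
   smooth extensions to V^2; every one has such an extension, by composing with
   the Gram-Schmidt retraction {det Gram > 0} -> St(2,V) and multiplying by a
   cutoff function of the Gram matrix. Only the values on St(2,V) matter: the
   identities in [is_levi_civita] are required there only, and the derivatives
   in them are taken along tangent directions. *)
Definition vector_field X : Prop :=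
  smooth X /\ forall p, stiefel p -> tangent p (X p).

Definition lie_bracket X Y : V2 -> V2 :=
  fun p => gateaux Y p (X p) - gateaux X p (Y p).

Record is_levi_civita (nabla : (V2 -> V2) -> (V2 -> V2) -> (V2 -> V2)) : Prop := {
  lc_field : forall X Y, vector_field X -> vector_field Y ->
    vector_field (nabla X Y);
  lc_ext : forall X X' Y Y', vector_field X -> vector_field X' ->
    vector_field Y -> vector_field Y' ->
    (forall p, stiefel p -> X p = X' p) ->
    (forall p, stiefel p -> Y p = Y' p) ->
    forall p, stiefel p -> nabla X Y p = nabla X' Y' p;
  lc_addl : forall X X' Y, vector_field X -> vector_field X' ->
    vector_field Y -> forall p, stiefel p ->
    nabla (fun q => X q + X' q) Y p = nabla X Y p + nabla X' Y p;
  lc_scalel : forall (g : V2 -> R^o) X Y, smooth g ->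
    vector_field X -> vector_field Y -> forall p, stiefel p ->
    nabla (fun q => g q *: X q) Y p = g p *: nabla X Y p;
  lc_addr : forall X Y Y', vector_field X -> vector_field Y ->
    vector_field Y' -> forall p, stiefel p ->
    nabla X (fun q => Y q + Y' q) p = nabla X Y p + nabla X Y' p;
  lc_leibniz : forall (g : V2 -> R^o) X Y, smooth g ->
    vector_field X -> vector_field Y -> forall p, stiefel p ->
    nabla X (fun q => g q *: Y q) p =
      gateaux g p (X p) *: Y p + g p *: nabla X Y p;
  lc_torsion_free : forall X Y, vector_field X -> vector_field Y ->
    forall p, stiefel p -> nabla X Y p - nabla Y X p = lie_bracket X Y p;
  lc_metric : forall X Y Z, vector_field X -> vector_field Y ->
    vector_field Z -> forall p, stiefel p ->
    gateaux (fun q => inner2 (Y q) (Z q) : R^o) p (X p) =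
      inner2 (nabla X Y p) (Z p) + inner2 (Y p) (nabla X Z p)
}.

Definition riemann (nabla : (V2 -> V2) -> (V2 -> V2) -> (V2 -> V2)) X Y Z :
    V2 -> V2 :=
  fun p => nabla X (nabla Y Z) p - nabla Y (nabla X Z) p
           - nabla (lie_bracket X Y) Z p.

(* [k] is the sectional curvature at [p] of the plane spanned by [xi], [eta].
   Since the metric is weak, the existence of the Levi-Civita connection is not
   automatic and is part of the assertion. *)
Definition is_sectional_curvature p xi eta (k : R) : Prop :=
  [/\ exists nabla, is_levi_civita nabla,
      exists X Y, [/\ vector_field X, vector_field Y, X p = xi & Y p = eta] &
      forall nabla X Y, is_levi_civita nabla ->
        vector_field X -> vector_field Y -> X p = xi -> Y p = eta ->
        inner2 (riemann nabla X Y Y p) xi /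
          (inner2 xi xi * inner2 eta eta - inner2 xi eta ^+ 2) = k].

Definition normV (f : V) : R := Num.sqrt (inner f f).

(* Elements of V (x) V are realised as kernels: f (x) g is (x, y) |-> f x * g y,
   and the Hilbert-Schmidt norm is the L^2 norm of the kernel. *)
Definition tensor (f g : V) : R -> R -> R := fun x y => f x * g y.

Definition hs_inner (S T : R -> R -> R) : R :=
  \int[lebesgue_measure]_(x in `[0, 2 * pi])
    \int[lebesgue_measure]_(y in `[0, 2 * pi]) (S x y * T x y).

Definition hs_norm (S : R -> R -> R) : R := Num.sqrt (hs_inner S S).

Lemma inner_integrable (f g : V) :
  lebesgue_measure.-integrable `[0, 2 * pi] (EFin \o (fun x => f x * g x)).
Proof.
apply: continuous_compact_integrable; first exact: segment_compact.
apply: continuous_subspaceT => x; apply: continuousM.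
- exact: (@V_continuous R b f 0).
- exact: (@V_continuous R b g 0).
Qed.

Lemma hs_inner_tensor (f g f' g' : V) :
  hs_inner (tensor f g) (tensor f' g') = inner f f' * inner g g'.
Proof.
rewrite /hs_inner /tensor.
under eq_Rintegral => x _.
  under eq_Rintegral => y _ do rewrite mulrACA.
  rewrite RintegralZl//; last exact: inner_integrable.
  over.
by rewrite RintegralZr//; exact: inner_integrable.
Qed.

End stiefel.

(* Main.v *)
(** [St(2,V)] is cut out of [V * V] by three quadratic equations, and its normal
    space at [(e, f)] is spanned by [(e, 0)], [(0, f)] and [(f, e)].
    Differentiating the equations of the tangent space along the manifold gives
    the normal part of [D_X Y] explicitly, as an expression bilinear in the
    values of [X] and [Y]; removing it gives the Levi-Civita connection. Its
    uniqueness needs no Riesz theorem, because the difference of two candidates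
    takes tangent values. The curvature is given by the Gauss equation
    [<R(X,Y)Y, X> = <II(X,X), II(Y,Y)> - |II(X,Y)|^2]: the second derivatives of
    [Y] cancel since they are symmetric.

    In the Frechet space [V] the mean value theorem is applied after composing
    with the functionals [f |-> c * f^(n)(t)], whose polars form a base of
    neighbourhoods of [0]. *)

Require Import Defs.
From mathcomp Require Import all_boot all_order all_algebra.
From mathcomp Require Import all_classical all_reals all_analysis.
From mathcomp Require Import ring lra.

Set Implicit Arguments.
Unset Strict Implicit.
Unset Printing Implicit Defensive.

Import Order.TTheory GRing.Theory Num.Theory.
Import numFieldNormedType.Exports.

Local Open Scope classical_set_scope.
Local Open Scope ring_scope.

(** * Differential calculus in locally convex spaces *)

(** Serves to replace a difference quotient by an algebraic rearrangement of it that is valid only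
    near the limit point. *)
Lemma cvg_near_eq {T : Type} {U : nbhsType} {F : set_system T} {FF : Filter F}
    (f g : T -> U) (l : U) :
  f @ F --> l -> (\forall x \near F, f x = g x) -> g @ F --> l.
Proof. by move=> fl fg; apply: cvg_trans fl; exact: near_eq_cvg. Qed.

Section tvs_limits.
Context {R : realType} {E : tvsType R} {T : Type} {F : set_system T}.
Context {FF : Filter F}.

Lemma tvs_cvgD (f g : T -> E) (a b : E) : f @ F --> a -> g @ F --> b ->
  (fun x => f x + g x) @ F --> a + b.
Proof.
by move=> *; apply: continuous2_cvg => //; exact: (@add_continuous _ (a, b)).
Qed.

Lemma tvs_cvgZ (k : T -> R) (f : T -> E) (c : R) (a : E) : k @ F --> c -> f @ F --> a ->
  (fun x => k x *: f x) @ F --> c *: a.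
Proof.
move=> kc fa.
exact: (@continuous2_cvg T R^o E E F FF k f (fun c a => c *: a) c a
  (@scale_continuous _ _ (c, a))).
Qed.

Lemma tvs_cvgN (f : T -> E) (a : E) : f @ F --> a -> (fun x => - f x) @ F --> - a.
Proof.
move=> fa; under eq_fun do rewrite -scaleN1r.
by rewrite -scaleN1r; apply: tvs_cvgZ => //; exact: cvg_cst.
Qed.

Lemma tvs_cvgB (f g : T -> E) (a b : E) : f @ F --> a -> g @ F --> b ->
  (fun x => f x - g x) @ F --> a - b.
Proof. by move=> fa gb; apply: tvs_cvgD => //; exact: tvs_cvgN. Qed.

End tvs_limits.

(** * Continuous functionals and their polars *)

Section functionals.
Context {R : realType}.

Definition functional (F : tvsType R) (l : F -> R) : Prop :=
  (forall a u v, l (a *: u + v) = a * l u + l v) /\ continuous l.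

(* By Hahn-Banach this holds for every Hausdorff locally convex space; here it
   is only needed, and checked by hand, for [V], [R] and their products. It
   reduces the mean value inequality to scalar functions. *)
Class polarized (F : tvsType R) : Prop := Polarized {
  polarized_nbhs : forall U : set F, nbhs (0 : F) U ->
    exists L : set (F -> R), [/\ forall l, L l -> functional l,
      nbhs (0 : F) [set u | forall l, L l -> `|l u| <= 1] &
      [set u | forall l, L l -> `|l u| <= 1] `<=` U];
  polarized_sep : forall u : F, (forall l, functional l -> l u = 0) -> u = 0
}.

Section functional_theory.
Context {F : tvsType R} {l : F -> R} (fl : functional l).

Lemma functional0 : l 0 = 0.
Proof. by have := fl.1 (-1) 0 0; rewrite scaler0 addr0 mulN1r addNr. Qed.

Lemma functionalZ a u : l (a *: u) = a * l u.
Proof. by rewrite -[a *: u]addr0 fl.1 functional0 addr0. Qed.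

Lemma functionalD u v : l (u + v) = l u + l v.
Proof. by rewrite -[u in LHS]scale1r fl.1 mul1r. Qed.

Lemma functionalB u v : l (u - v) = l u - l v.
Proof. by rewrite functionalD -scaleN1r functionalZ mulN1r. Qed.

Lemma functional_cvg {T} {G : set_system T} {FG : Filter G} (f : T -> F) a :
  f @ G --> a -> (fun x => l (f x)) @ G --> l a.
Proof. by move=> fa; exact: (cvg_comp f l fa (fl.2 a)). Qed.

End functional_theory.

Lemma polarized_eq (F : tvsType R) {pF : polarized F} (u v : F) :
  (forall l, functional l -> l u = l v) -> u = v.
Proof.
move=> H; apply/eqP; rewrite -subr_eq0; apply/eqP/polarized_sep => l fl.
by rewrite functionalB// H// subrr.
Qed.

(** Functionals carry both limits to [R], where limits are unique, and they separate points. This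
    stands in for a Hausdorff axiom. *)
Lemma polarized_unique (F : tvsType R) {pF : polarized F} T (G : set_system T)
  {FG : ProperFilter G} (f : T -> F) (a c : F) :
  f @ G --> a -> f @ G --> c -> a = c.
Proof.
move=> fa fc; apply: polarized_eq => l fl.
exact: (@cvg_unique _ (@Rhausdorff R) _ _ _ _
  (functional_cvg fl fa) (functional_cvg fl fc)).
Qed.

#[export] Instance polarized_regular : polarized (R^o : tvsType R).
Proof.
split=> [U U0|u /(_ idfun)]; last first.
  by apply; split=> // x; exact: cvg_id.
have /nbhs_ballP [e /= e0 eU] := U0.
(* The polar of the single functional [u |-> 2 / e * u] is the closed ball of radius [e / 2], which
   lies in the open ball of radius [e]. *)
have e20 : 0 < 2 / e by rewrite divr_gt0.
exists [set (fun u : R^o => (2 / e) * u)]; split.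
- move=> _ ->; split=> [a u v|x]; last exact: (@mulrl_continuous R (2 / e) x).
  by rewrite mulrDr mulrCA.
- apply/nbhs_ballP; exists (e / 2) => /=; first by rewrite divr_gt0.
  move=> u; rewrite -ball_normE/= sub0r normrN => u1 _ ->.
  by rewrite normrM gtr0_norm// -ler_pdivlMl// invf_div mulr1 ltW.
- move=> u /(_ _ erefl); rewrite normrM gtr0_norm// -ler_pdivlMl// invf_div mulr1.
  move=> u1; apply: eU; rewrite -ball_normE/= sub0r normrN.
  by rewrite (le_lt_trans u1)// ltr_pdivrMr// ltr_pMr// ltr1n.
Qed.

(** Functionals of either factor are pulled back along the projections; the polar of the union of
    two pulled-back families is the product of their polars. *)
#[export] Instance polarized_prod (E F : tvsType R) :
  polarized E -> polarized F -> polarized (E * F)%type.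
Proof.
have ffst l : functional l -> functional (fun u : E * F => l u.1).
  move=> fl; split=> [a u v|x]; first exact: fl.1.
  exact: (functional_cvg fl (f := fst) cvg_fst).
have fsnd l : functional l -> functional (fun u : E * F => l u.2).
  move=> fl; split=> [a u v|x]; first exact: fl.1.
  exact: (functional_cvg fl (f := snd) cvg_snd).
move=> pE pF; split=> [U [[A B] [/= A0 B0] ABU]|[u v] H].
  have [L [Ll L0 LA]] := polarized_nbhs A0.
  have [M [Ml M0 MB]] := polarized_nbhs B0.
  exists ([set (fun u : E * F => l u.1) | l in L] `|`
          [set (fun u : E * F => l u.2) | l in M]); split.
  - by move=> _ [[l Ll' <-]|[l Ml' <-]]; [exact/ffst/Ll|exact/fsnd/Ml].
  - exists (([set u | forall l, L l -> `|l u| <= 1]),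
      [set u | forall l, M l -> `|l u| <= 1]) => //.
    by move=> [u v] [/= Lu Mv] _ [[l Ll' <-]|[l Ml' <-]]; [exact: Lu|exact: Mv].
  - move=> [u v] H; apply: ABU; split.
    + by apply: LA => l Ll'; apply: (H (fun u : E * F => l u.1)); left; exists l.
    + by apply: MB => l Ml'; apply: (H (fun u : E * F => l u.2)); right; exists l.
congr pair.
- by apply: polarized_sep => l fl; exact: (H _ (ffst _ fl)).
- by apply: polarized_sep => l fl; exact: (H _ (fsnd _ fl)).
Qed.

End functionals.

(** * Directional derivatives, mean value inequality and chain rule *)

Section gateaux_theory.
Context {R : realType}.

Lemma gateaux_eq (E F : tvsType R) {pF : polarized F} (f : E -> F) p v l :
  is_gateaux f p v l -> gateaux f p v = l.
Proof.
move=> fl; rewrite /gateaux; case: xgetP => [l' _ fl'|/(_ l)//].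
exact: polarized_unique fl' fl.
Qed.

Lemma gateauxP (E F : tvsType R) (f : E -> F) p v :
  (exists l, is_gateaux f p v l) -> is_gateaux f p v (gateaux f p v).
Proof. by move=> [l fl]; rewrite /gateaux; exact: (xgetPex 0 (ex_intro _ l fl)). Qed.

(** For nonzero [k], the quotient along [k *: v] at [h] is [k] times the quotient along [v] at
    [h * k]. For [k = 0] the quotient is constantly zero. *)
Lemma is_gateauxZ (E F : tvsType R) (f : E -> F) p v l (k : R) :
  is_gateaux f p v l -> is_gateaux f p (k *: v) (k *: l).
Proof.
move=> fl; have [->|k0] := eqVneq k 0.
  rewrite /is_gateaux scale0r; apply: cvg_near_cst; near=> h.
  by rewrite scale0r scaler0 addr0 subrr scaler0.
rewrite /is_gateaux.
rewrite (_ : (fun h : R => _) = fun h : R =>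
    k *: ((h * k)^-1 *: (f (p + (h * k) *: v) - f p))); last first.
  apply/funext => h; rewrite !scalerA invfM mulrCA.
  by rewrite [X in _ *: X]/= mulfV// mulr1.
apply: tvs_cvgZ; first exact: cvg_cst.
apply: (cvg_comp (fun h : R => h * k)
  (fun h => h^-1 *: (f (p + h *: v) - f p))) fl.
move=> A /= [e /= e0 eA]; exists (e / `|k|); first by rewrite /= divr_gt0// normr_gt0.
move=> h /=; rewrite sub0r normrN => he h0; apply: eA => /=.
  by rewrite sub0r normrN normrM -ltr_pdivlMr ?normr_gt0.
by rewrite mulf_neq0.
Unshelve. all: by end_near. Qed.

(** The scalar mean value theorem for [t |-> l (f (p + t *: v))] on the unit interval. The point [s]
    depends on [l], so estimates built on it must be uniform in [s]. *)
Lemma mvt_functional (E F : tvsType R) (f : E -> F) (l : F -> R) p v :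
  functional l -> (forall q w, exists d, is_gateaux f q w d) ->
  exists2 s : R, 0 <= s <= 1 & l (f (p + v) - f p) = l (gateaux f (p + s *: v) v).
Proof.
move=> fl df; pose phi (t : R) := l (f (p + t *: v)).
have dphi (t : R) : is_derive t 1 phi (l (gateaux f (p + t *: v) v)).
  have H : (fun h => h^-1 *: ((phi \o shift t) (h *: 1) - phi t)) @ 0^' -->
      l (gateaux f (p + t *: v) v).
    refine (cvg_near_eq (functional_cvg fl (gateauxP (df (p + t *: v) v))) _).
    near=> h.
    rewrite functionalZ// functionalB//= /phi; congr (_ * (l (f _) - _)).
    by rewrite -addrA -scalerDl addrC -[h *: 1]/(h * 1) mulr1 addrC (addrC h).
  by apply: DeriveDef; [exact: (cvgP _ H)|exact: cvg_lim].
have cphi : {within `[0, 1], continuous phi}.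
  by apply: derivable_within_continuous => x _; have [] := dphi x.
have [s s01] := MVT_segment ler01 (fun x _ => dphi x) cphi.
rewrite subr0 mulr1 /phi scale1r scale0r addr0 -functionalB// => ->.
by exists s => //; rewrite in_itv/= in s01.
Unshelve. all: by end_near. Qed.

Definition C1 (E F : tvsType R) (f : E -> F) : Prop :=
  (forall p v, exists l, is_gateaux f p v l) /\
  continuous (fun pv : E * E => gateaux f pv.1 pv.2).

Lemma C1_gateaux (E F : tvsType R) (f : E -> F) p v :
  C1 f -> is_gateaux f p v (gateaux f p v).
Proof. by move=> [df _]; exact: gateauxP. Qed.

(** Strict differentiability: base point and direction may both vary with [h]. Additivity in the
    direction, the chain rule and derivatives along curves all reduce to it. For each functional of
    a family whose polar lies in [U], the mean value theorem turns the quotient into a derivative at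
    a point close to [p]. *)
Lemma C1_strict (E F : tvsType R) {pF : polarized F} (f : E -> F) p v
  (a w : R -> E) : C1 f ->
  a @ 0^' --> p -> w @ 0^' --> v ->
  (fun h => h^-1 *: (f (a h + h *: w h) - f (a h))) @ 0^' --> gateaux f p v.
Proof.
move=> [df cf] ap wv.
set G := gateaux f p v.
suff H : (fun h => h^-1 *: (f (a h + h *: w h) - f (a h)) - G) @ 0^' --> (0 : F).
  rewrite -[X in _ --> X]add0r.
  refine (cvg_near_eq (tvs_cvgD H (cvg_cst G)) _).
  by near=> h; rewrite subrK.
move=> U /polarized_nbhs[L [Ll L0 LU]]; apply: filterS LU _; rewrite nbhs_filterE.
(* Joint continuity of the derivative gives neighbourhoods [A] of [p] and [B] of [v] on which its
   deviation from [G] stays in the polar. *)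
have : (fun pv : E * E => gateaux f pv.1 pv.2 - G) @ (p, v) --> (0 : F).
  rewrite -(subrr G); refine (tvs_cvgB (cf (p, v)) (cvg_cst G)).
move=> /(_ _ L0) -[[A B] [/= Ap Bv] AB].
(* Keeps the intermediate point [a h + (s * h) *: w h] in [A] for every [s] between 0 and 1 at once,
   since only [s * h] in the ball of radius [e] is asked. *)
have : (fun z : E * (R^o * E) => z.1 + z.2.1 *: z.2.2) @ (p, (0 : R^o, v)) --> p.
  rewrite -[X in _ --> X]addr0 -(scale0r v).
  apply: tvs_cvgD; first exact: cvg_fst.
  apply: tvs_cvgZ.
    exact: (@cvg_comp _ _ _ snd fst _ _ _ cvg_snd cvg_fst).
  exact: (@cvg_comp _ _ _ snd snd _ _ _ cvg_snd cvg_snd).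
move=> /(_ _ Ap) -[[P Q] [/= Pp [[K W] [/= K0 Wv] KWQ]] PQ].
move: K0 => /nbhs_ballP[e /= e0 eK].
have Aw : \forall h \near (0 : R)^', B (w h) by exact: wv.
have Ww : \forall h \near (0 : R)^', W (w h) by exact: wv.
have Pa : \forall h \near (0 : R)^', P (a h) by exact: ap.
near=> h => l Ll'; have fl := Ll _ Ll'.
have h0 : h != 0 by near: h; exact: nbhs_dnbhs_neq.
have [s s01 E1] := mvt_functional (a h) (h *: w h) fl df.
rewrite functionalB// functionalZ// E1.
have -> : gateaux f (a h + s *: (h *: w h)) (h *: w h) =
    h *: gateaux f (a h + (s * h) *: w h) (w h).
  by rewrite scalerA; apply: gateaux_eq; apply: is_gateauxZ; exact: gateauxP.
rewrite functionalZ// mulKf// -functionalB//.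
apply: (AB (_, _)) => //=; split => /=; last by near: h.
apply: (PQ (_, (_, _))); split => /=; first by near: h.
apply: (KWQ (_, _)); split => /=; last by near: h.
apply: eK; rewrite -ball_normE/= sub0r normrN normrM.
case/andP: s01 => s0 s1; rewrite (ger0_norm s0).
apply: (@le_lt_trans _ _ `|h|); first by rewrite ler_piMl.
by near: h; exact: dnbhs0_lt.
Unshelve. all: by end_near. Qed.

(** The increment is split at [p + h *: v]; its second piece is a quotient along [w] with moving
    base point, hence the appeal to [C1_strict]. *)
Lemma gateauxD_dir (E F : tvsType R) {pF : polarized F} (f : E -> F) p v w :
  C1 f -> gateaux f p (v + w) = gateaux f p v + gateaux f p w.
Proof.
move=> Cf; apply: gateaux_eq.
have pv : (fun h : R => p + h *: v) @ 0^' --> p.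
  rewrite -[X in _ --> X]addr0 -(scale0r v); apply: tvs_cvgD; first exact: cvg_cst.
  apply: tvs_cvgZ; last exact: cvg_cst.
  by apply: cvg_within.
refine (cvg_near_eq
  (tvs_cvgD (C1_gateaux Cf) (C1_strict Cf pv (cvg_cst w))) _).
near=> h.
by rewrite -scalerDr (scalerDr h v w) (addrA p) [X in _ *: X = _]addrC subrKA.
Unshelve. all: by end_near. Qed.

Lemma gateauxZ_dir (E F : tvsType R) {pF : polarized F} (f : E -> F) p v (k : R) :
  C1 f -> gateaux f p (k *: v) = k *: gateaux f p v.
Proof. by move=> Cf; apply: gateaux_eq; apply: is_gateauxZ; exact: C1_gateaux. Qed.

Lemma gateauxB_dir (E F : tvsType R) {pF : polarized F} (f : E -> F) p v w :
  C1 f -> gateaux f p (v - w) = gateaux f p v - gateaux f p w.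
Proof. by move=> Cf; rewrite gateauxD_dir// -scaleN1r gateauxZ_dir// scaleN1r. Qed.

Lemma is_gateaux_line (E F : tvsType R) (f : E -> F) p v l :
  is_gateaux f p v l -> (fun h : R => f (p + h *: v)) @ 0^' --> f p.
Proof.
move=> fl.
have h0 : (fun h : R => h) @ 0^' --> (0 : R) by apply: cvg_within.
rewrite -[X in _ --> X]addr0 -(scale0r l).
refine (cvg_near_eq (tvs_cvgD (cvg_cst (f p)) (tvs_cvgZ h0 fl)) _).
near=> h.
rewrite scalerA mulfV ?scale1r ?subrKC//.
by near: h; exact: nbhs_dnbhs_neq.
Unshelve. all: by end_near. Qed.

(** For [h] nonzero, [f (p + h *: v)] is [f p] plus [h] times the quotient of [f]; that quotient is
    the moving direction in [C1_strict] for [g]. *)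
Lemma is_gateaux_comp (D E F : tvsType R) {pF : polarized F}
    (f : D -> E) (g : E -> F) p v d : is_gateaux f p v d -> C1 g ->
  is_gateaux (g \o f) p v (gateaux g (f p) d).
Proof.
move=> fd Cg; refine (cvg_near_eq (C1_strict Cg (cvg_cst (f p)) fd) _).
near=> h => /=.
rewrite scalerA mulfV ?scale1r ?subrKC//.
by near: h; exact: nbhs_dnbhs_neq.
Unshelve. all: by end_near. Qed.

Lemma gateaux_comp (D E F : tvsType R) {pF : polarized F}
    (f : D -> E) (g : E -> F) p v : C1 f -> C1 g ->
  gateaux (g \o f) p v = gateaux g (f p) (gateaux f p v).
Proof.
by move=> Cf Cg; apply: gateaux_eq; apply: is_gateaux_comp => //; exact: C1_gateaux.
Qed.

Lemma is_gateaux_pair (D E F : tvsType R) (f : D -> E) (g : D -> F) p v d d' :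
  is_gateaux f p v d -> is_gateaux g p v d' ->
  is_gateaux (fun x => (f x, g x)) p v (d, d').
Proof. by move=> fd gd; exact: (cvg_pair fd gd). Qed.

Lemma is_gateaux_linear (E F : tvsType R) (L : E -> F) p v :
  (forall a u w, L (a *: u + w) = a *: L u + L w) -> is_gateaux L p v (L v).
Proof.
move=> lL; apply: cvg_near_cst; near=> h.
rewrite (addrC p) lL addrK scalerA mulVf ?scale1r//.
by near: h; exact: nbhs_dnbhs_neq.
Unshelve. all: by end_near. Qed.

Lemma is_gateaux_cst (E F : tvsType R) (c : F) p v :
  is_gateaux (fun _ : E => c) p v 0.
Proof.
apply: cvg_near_cst; near=> h.
by rewrite subrr scaler0.
Unshelve. all: by end_near. Qed.

Record bilinear_continuous (E F G : tvsType R) (B : E -> F -> G) : Prop := {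
  bilinear_l : forall y a u v, B (a *: u + v) y = a *: B u y + B v y;
  bilinear_r : forall x a u v, B x (a *: u + v) = a *: B x u + B x v;
  bilinear_cont : continuous (fun z : E * F => B z.1 z.2)
}.

Lemma bilinear_cvg (E F G : tvsType R) (B : E -> F -> G) (T : Type)
    (Fi : set_system T) {FFi : Filter Fi} (f : T -> E) (g : T -> F) a c :
  bilinear_continuous B -> f @ Fi --> a -> g @ Fi --> c ->
  (fun x => B (f x) (g x)) @ Fi --> B a c.
Proof.
move=> BB fa gc.
refine (cvg_comp (fun x => (f x, g x)) (fun z => B z.1 z.2) (cvg_pair fa gc) _).
exact: (@bilinear_cont _ _ _ _ BB (a, c)).
Qed.

(** The increment is the increment of [f] paired with [g (p + h *: v)], plus [f p] paired with the
    increment of [g]; [is_gateaux_line] gives the limit of the shifted factor. *)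
Lemma is_gateaux_bilinear (D E F G : tvsType R) (B : E -> F -> G)
    (f : D -> E) (g : D -> F) p v d d' :
  bilinear_continuous B -> is_gateaux f p v d -> is_gateaux g p v d' ->
  is_gateaux (fun x => B (f x) (g x)) p v (B d (g p) + B (f p) d').
Proof.
move=> BB fd gd.
refine (cvg_near_eq (tvs_cvgD (bilinear_cvg BB fd (is_gateaux_line gd))
  (bilinear_cvg BB (cvg_cst (f p)) gd)) _).
near=> h.
have Bl0 y : B 0 y = 0.
  by have := bilinear_l BB y (-1) 0 0; rewrite scaler0 addr0 scaleN1r addNr.
have Br0 x : B x 0 = 0.
  by have := bilinear_r BB x (-1) 0 0; rewrite scaler0 addr0 scaleN1r addNr.
have BlZ y a u : B (a *: u) y = a *: B u y.
  by rewrite -[a *: u]addr0 (bilinear_l BB) Bl0 addr0.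
have BrZ x a u : B x (a *: u) = a *: B x u.
  by rewrite -[a *: u]addr0 (bilinear_r BB) Br0 addr0.
have BlB y u u' : B (u - u') y = B u y - B u' y.
  by rewrite addrC -scaleN1r (bilinear_l BB) scaleN1r addrC.
have BrB x u u' : B x (u - u') = B x u - B x u'.
  by rewrite addrC -scaleN1r (bilinear_r BB) scaleN1r addrC.
by rewrite BlZ BrZ -scalerDr BlB BrB addrA subrK.
Unshelve. all: by end_near. Qed.

End gateaux_theory.

(** * Michal-Bastiani smooth maps *)

Section Ck_theory.
Context {R : realType}.
Implicit Types (D E F G : tvsType R).

Lemma Ck_continuous k E F (f : E -> F) : Ck k f -> continuous f.
Proof. by case: k => [//|k] []. Qed.

Lemma Ck_pred k E F (f : E -> F) : Ck k.+1 f -> Ck k f.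
Proof.
elim: k E F f => [|k IH] E F f; first by case.
by move=> [cf df Cf]; split=> //; exact: IH.
Qed.

Lemma Ck_C1 k E F (f : E -> F) : Ck k.+1 f -> C1 f.
Proof. by move=> [cf df /Ck_continuous]. Qed.

Lemma gateaux_pair D E F {pE : polarized E} {pF : polarized F}
    (f : D -> E) (g : D -> F) p v : C1 f -> C1 g ->
  gateaux (fun x => (f x, g x)) p v = (gateaux f p v, gateaux g p v).
Proof.
by move=> Cf Cg; apply: gateaux_eq; apply: is_gateaux_pair; exact: C1_gateaux.
Qed.

Lemma Ck_pair k D E F {pE : polarized E} {pF : polarized F}
    (f : D -> E) (g : D -> F) : Ck k f -> Ck k g ->
  Ck k (fun x => (f x, g x)).
Proof.
elim: k D E F pE pF f g => [|k IH] D E F pE pF f g Cf Cg.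
  by move=> x; exact: cvg_pair (Cf x) (Cg x).
have [cf df Df] := Cf; have [cg dg Dg] := Cg; split.
- by move=> x; exact: cvg_pair (cf x) (cg x).
- move=> p v; exists (gateaux f p v, gateaux g p v).
  by apply: is_gateaux_pair; exact: gateauxP.
- under eq_fun do rewrite (gateaux_pair _ _ (Ck_C1 Cf) (Ck_C1 Cg)).
  exact: IH.
Qed.

Lemma Ck_cst k E F {pF : polarized F} (c : F) : Ck k (fun _ : E => c).
Proof.
elim: k E c => [|k IH] E c; first by move=> x; exact: cvg_cst.
split; first by move=> x; exact: cvg_cst.
- by move=> p v; exists 0; exact: is_gateaux_cst.
- under eq_fun do rewrite (gateaux_eq (@is_gateaux_cst _ _ _ _ _ _)).
  exact: IH.
Qed.

(** The derivative is [(p, v) |-> L v], again linear and continuous but on [E * E], so the induction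
    ranges over all source spaces. *)
Lemma Ck_linear k E F {pF : polarized F} (L : E -> F) :
  (forall a u w, L (a *: u + w) = a *: L u + L w) -> continuous L -> Ck k L.
Proof.
elim: k E L => [//|k IH] E L lL cL; split=> //.
- by move=> p v; exists (L v); exact: is_gateaux_linear.
- under eq_fun do rewrite (gateaux_eq (@is_gateaux_linear _ _ _ L _ _ lL)).
  apply: IH => [a u w|x]; first exact: lL.
  exact: (cvg_comp snd L cvg_snd (cL x.2)).
Qed.

Lemma Ck_id k E {pE : polarized E} : Ck k (fun x : E => x).
Proof. by apply: Ck_linear => // x; exact: cvg_id. Qed.

Lemma Ck_fst k E F {pE : polarized E} : Ck k (fun x : E * F => x.1).
Proof. by apply: Ck_linear => // x; exact: cvg_fst. Qed.

Lemma Ck_snd k E F {pF : polarized F} : Ck k (fun x : E * F => x.2).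
Proof. by apply: Ck_linear => // x; exact: cvg_snd. Qed.

(** By the chain rule the derivative of the composite is the derivative of [g] after
    [(p, v) |-> (f p, D_v f (p))]: once more a composite, one order lower. *)
Lemma Ck_comp k D E F {pD : polarized D} {pE : polarized E} {pF : polarized F}
    (f : D -> E) (g : E -> F) : Ck k f -> Ck k g -> Ck k (fun x => g (f x)).
Proof.
elim: k D E F pD pE pF f g => [|k IH] D E F pD pE pF f g Cf Cg.
  by move=> x; exact: (cvg_comp f g (Cf x) (Cg (f x))).
have C1f := Ck_C1 Cf; have C1g := Ck_C1 Cg.
have [cf df Df] := Cf; have [cg dg Dg] := Cg; split.
- by move=> x; exact: (cvg_comp f g (cf x) (cg (f x))).
- move=> p v; exists (gateaux g (f p) (gateaux f p v)).
  by apply: (is_gateaux_comp _ C1g); exact: gateauxP.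
- under eq_fun do rewrite (gateaux_comp _ _ C1f C1g).
  have C1' : Ck k (fun pv : D * D => f pv.1).
    by apply: (IH _ _ _ _ _ _ fst f); [exact: Ck_fst|exact: Ck_pred].
  exact: (IH _ _ _ _ _ _ (fun pv : D * D => (f pv.1, gateaux f pv.1 pv.2))
    (fun pv : E * E => gateaux g pv.1 pv.2) (Ck_pair C1' Df) Dg).
Qed.

Lemma CkD k D E {pD : polarized D} {pE : polarized E} (f g : D -> E) :
  Ck k f -> Ck k g -> Ck k (fun x => f x + g x).
Proof.
move=> Cf Cg; apply: (Ck_comp (Ck_pair Cf Cg) (g := fun z : E * E => z.1 + z.2)).
apply: Ck_linear; last exact: (@add_continuous E).
by move=> a [u u'] [w w'] /=; rewrite scalerDr addrACA.
Qed.

(** By the product rule the derivative is a sum of two terms with the same [B], with factors of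
    class [Ck k] on [D * D]. *)
Lemma Ck_bilinear k D E F G {pD : polarized D} {pE : polarized E} {pF : polarized F}
    {pG : polarized G} (B : E -> F -> G) (f : D -> E) (g : D -> F) :
  bilinear_continuous B -> Ck k f -> Ck k g -> Ck k (fun x => B (f x) (g x)).
Proof.
move=> BB; elim: k D pD f g => [|k IH] D pD f g Cf Cg.
  by move=> x; exact: (bilinear_cvg BB (Cf x) (Cg x)).
have C1f := Ck_C1 Cf; have C1g := Ck_C1 Cg.
have [cf df Df] := Cf; have [cg dg Dg] := Cg; split.
- by move=> x; exact: (bilinear_cvg BB (cf x) (cg x)).
- move=> p v; exists (B (gateaux f p v) (g p) + B (f p) (gateaux g p v)).
  by apply: is_gateaux_bilinear => //; exact: gateauxP.
- under eq_fun do rewrite (gateaux_eq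
    (@is_gateaux_bilinear _ _ _ _ _ B f g _ _ _ _ BB
      (C1_gateaux C1f) (C1_gateaux C1g))).
  apply: CkD; apply: IH => //.
  + apply: (@Ck_comp k (D * D)%type D F _ _ _ fst g); first exact: Ck_fst.
    exact: Ck_pred.
  + apply: (@Ck_comp k (D * D)%type D E _ _ _ fst f); first exact: Ck_fst.
    exact: Ck_pred.
Qed.

End Ck_theory.

(** * Smooth maps and rules for their derivatives *)

Section smooth_theory.
Context {R : realType}.
Implicit Types (D E F G : tvsType R).

Lemma smooth_C1 E F (f : E -> F) : smooth f -> C1 f.
Proof. by move=> /(_ 1%N)/Ck_C1. Qed.

Lemma smooth_dgateaux E F (f : E -> F) :
  smooth f -> smooth (fun pv : E * E => gateaux f pv.1 pv.2).
Proof. by move=> sf k; have [] := sf k.+1. Qed.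

Lemma smooth_comp D E F {pD : polarized D} {pE : polarized E} {pF : polarized F}
    (f : D -> E) (g : E -> F) :
  smooth f -> smooth g -> smooth (fun x => g (f x)).
Proof. by move=> sf sg k; apply: Ck_comp. Qed.

Lemma smooth_pair D E F {pE : polarized E} {pF : polarized F}
    (f : D -> E) (g : D -> F) :
  smooth f -> smooth g -> smooth (fun x => (f x, g x)).
Proof. by move=> sf sg k; apply: Ck_pair. Qed.

Lemma smooth_cst E F {pF : polarized F} (c : F) : smooth (fun _ : E => c).
Proof. by move=> k; exact: Ck_cst. Qed.

Lemma smooth_id E {pE : polarized E} : smooth (fun x : E => x).
Proof. by move=> k; exact: Ck_id. Qed.

Lemma smooth_fst D E F {pD : polarized D} {pE : polarized E}
    {pF : polarized F} (f : D -> E * F) :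
  smooth f -> smooth (fun x => (f x).1).
Proof. by move=> sf; apply: (smooth_comp sf (g := fst)) => k; exact: Ck_fst. Qed.

Lemma smooth_snd D E F {pD : polarized D} {pE : polarized E}
    {pF : polarized F} (f : D -> E * F) :
  smooth f -> smooth (fun x => (f x).2).
Proof. by move=> sf; apply: (smooth_comp sf (g := snd)) => k; exact: Ck_snd. Qed.

Lemma smoothD D E {pD : polarized D} {pE : polarized E} (f g : D -> E) :
  smooth f -> smooth g -> smooth (fun x => f x + g x).
Proof. by move=> sf sg k; exact: CkD. Qed.

Lemma smooth_bilinear D E F G {pD : polarized D} {pE : polarized E} {pF : polarized F}
    {pG : polarized G} (B : E -> F -> G) (f : D -> E) (g : D -> F) :
  bilinear_continuous B -> smooth f -> smooth g ->
  smooth (fun x => B (f x) (g x)).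
Proof. by move=> BB sf sg k; exact: Ck_bilinear. Qed.

Lemma scale_bilinear E : bilinear_continuous (fun (k : R^o) (u : E) => k *: u).
Proof.
split; last exact: scale_continuous.
- by move=> y a u v; rewrite scalerDl scalerA.
- by move=> x a u v; rewrite scalerDr !scalerA mulrC.
Qed.

Lemma smoothZ D E {pD : polarized D} {pE : polarized E} (f : D -> R^o) (g : D -> E) :
  smooth f -> smooth g -> smooth (fun x => f x *: g x).
Proof. exact: smooth_bilinear (@scale_bilinear E). Qed.

Lemma smoothN D E {pD : polarized D} {pE : polarized E} (f : D -> E) :
  smooth f -> smooth (fun x => - f x).
Proof.
move=> sf; under eq_fun do rewrite -scaleN1r.
by apply: smoothZ => //; exact: smooth_cst.
Qed.

Lemma gateaux_cst E F {pF : polarized F} (c : F) p v :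
  gateaux (fun _ : E => c) p v = 0.
Proof. exact/gateaux_eq/is_gateaux_cst. Qed.

Lemma gateaux_id E {pE : polarized E} (p v : E) : gateaux (fun x => x) p v = v.
Proof. by apply: gateaux_eq; exact: is_gateaux_linear. Qed.

Lemma gateaux_fst D E F {pE : polarized E} (f : D -> E * F) p v : C1 f ->
  gateaux (fun x => (f x).1) p v = (gateaux f p v).1.
Proof.
move=> Cf; apply: gateaux_eq.
exact: (cvg_comp _ fst (C1_gateaux Cf) cvg_fst).
Qed.

Lemma gateaux_snd D E F {pF : polarized F} (f : D -> E * F) p v : C1 f ->
  gateaux (fun x => (f x).2) p v = (gateaux f p v).2.
Proof.
move=> Cf; apply: gateaux_eq.
exact: (cvg_comp _ snd (C1_gateaux Cf) cvg_snd).
Qed.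

Lemma gateauxD D E {pE : polarized E} (f g : D -> E) p v : C1 f -> C1 g ->
  gateaux (fun x => f x + g x) p v = gateaux f p v + gateaux g p v.
Proof.
move=> Cf Cg; apply: gateaux_eq.
refine (cvg_near_eq (tvs_cvgD (C1_gateaux Cf) (C1_gateaux Cg)) _).
by near=> h; rewrite -scalerDr opprD addrACA.
Unshelve. all: by end_near. Qed.

Lemma gateaux_bilinear D E F G {pG : polarized G} (B : E -> F -> G)
    (f : D -> E) (g : D -> F) p v : bilinear_continuous B -> C1 f -> C1 g ->
  gateaux (fun x => B (f x) (g x)) p v =
  B (gateaux f p v) (g p) + B (f p) (gateaux g p v).
Proof.
by move=> BB Cf Cg; apply: gateaux_eq; apply: is_gateaux_bilinear => //;
  exact: C1_gateaux.
Qed.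

Lemma gateauxZ D E {pE : polarized E} (f : D -> R^o) (g : D -> E) p v :
  C1 f -> C1 g ->
  gateaux (fun x => f x *: g x) p v =
  gateaux f p v *: g p + f p *: gateaux g p v.
Proof. exact: gateaux_bilinear (@scale_bilinear E). Qed.

(** * Symmetry of second derivatives *)

Section schwarz.
Context {E F : tvsType R} {pF : polarized F}.
Variable f : E -> F.
Let Df (pv : E * E) : F := gateaux f pv.1 pv.2.
Hypothesis Cf : C1 f.
Hypothesis CDf : C1 Df.

(** The mean value theorem is used twice: on [q |-> f (q + h *: v) - f q] along [h *: u], then on
    [Df] along [h *: (v, 0)]. The resulting intermediate point tends to [p] with [h], and [CDf]
    gives the limit. *)
Let second_difference p u v (l : F -> R) : functional l ->
  (fun h : R => (h ^+ 2)^-1 *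
     l ((f (p + h *: u + h *: v) - f (p + h *: u)) - (f (p + h *: v) - f p)))
  @ 0^' --> l (gateaux Df (p, u) (v, 0)).
Proof.
move=> fl.
have line0 : (fun z : R^o * R^o => p + z.1 *: u + z.2 *: v) @ (0 : R^o, 0 : R^o)
    --> p.
  have -> : nbhs p = nbhs (p + (0 : R) *: u + (0 : R) *: v).
    by rewrite !scale0r !addr0.
  refine (tvs_cvgD (tvs_cvgD (cvg_cst p) (tvs_cvgZ cvg_fst (cvg_cst u)))
    (tvs_cvgZ cvg_snd (cvg_cst v))).
have cphi : (fun z : R^o * R^o =>
    l (gateaux Df (p + z.1 *: u + z.2 *: v, u) (v, 0))) @ (0 : R^o, 0 : R^o) -->
    l (gateaux Df (p, u) (v, 0)).
  refine (functional_cvg fl _).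
  refine (cvg_comp (fun z : R^o * R^o =>
    ((p + z.1 *: u + z.2 *: v, u), (v, (0 : E))))
    (fun w : (E * E) * (E * E) => gateaux Df w.1 w.2) _
    (@proj2 _ _ CDf ((p, u), (v, 0)))).
  refine (cvg_pair (cvg_pair _ (cvg_cst u)) (cvg_cst (v, 0))).
  exact: line0.
apply/cvgrPdist_lt => e e0.
move: cphi => /cvgrPdist_lt /(_ _ e0)[[P Q] [/= P0 Q0] PQ].
move: P0 Q0 => /nbhs_ballP[d /= d0 dP] /nbhs_ballP[d' /= d'0 dQ].
near=> h.
have h0 : h != 0 by near: h; exact: nbhs_dnbhs_neq.
have small s (k : R) : 0 <= s <= 1 -> `|h| < k -> ball (0 : R) k (s * h).
  move=> /andP[s0 s1] hk; rewrite -ball_normE/= sub0r normrN normrM ger0_norm//.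
  by rewrite (le_lt_trans _ hk)// ler_piMl.
pose g q := f (q + h *: v) - f q.
have dg q w : is_gateaux g q w (Df (q + h *: v, w) - Df (q, w)).
  refine (cvg_near_eq (tvs_cvgB (C1_gateaux Cf) (C1_gateaux Cf)) _).
  near=> k; rewrite -scalerBr /g; congr (_ *: _).
  by rewrite (addrAC q (h *: v)) !opprD addrACA.
have [s s01] := mvt_functional p (h *: u) fl (fun q w => ex_intro _ _ (dg q w)).
rewrite /g (gateaux_eq (dg _ _)) => ->.
have DZ q : Df (q, h *: u) = h *: Df (q, u) by exact: gateauxZ_dir.
rewrite !DZ -scalerBr (functionalZ fl).
have [r r01] := mvt_functional (p + s *: (h *: u), u) (h *: (v, 0)) fl CDf.1.
rewrite gateauxZ_dir// (functionalZ fl).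
rewrite [X in Df X](_ : _ = (p + s *: (h *: u) + h *: v, u)); last first.
  by congr pair; rewrite /= scaler0 addr0.
rewrite [X in gateaux Df X](_ : _ = (p + (s * h) *: u + (r * h) *: v, u)); last first.
  by congr pair; rewrite /= !scalerA ?mulr0 ?scaler0 ?addr0.
move=> ->; rewrite (mulrA h h) -expr2 mulKf ?expf_neq0//.
apply: (PQ (_, _)); split => /=.
- by apply: dP; apply: small => //; near: h; exact: dnbhs0_lt.
- by apply: dQ; apply: small => //; near: h; exact: dnbhs0_lt.
Unshelve. all: by end_near. Qed.

(** The second difference is unchanged when [u] and [v] are exchanged, so under every functional
    both sides are limits of one real function. *)
Lemma gateaux_schwarz p u v :
  gateaux Df (p, u) (v, 0) = gateaux Df (p, v) (u, 0).
Proof.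
apply: polarized_eq => l fl.
refine (@cvg_unique _ (@Rhausdorff R) _ _ _ _ (@second_difference p u v l fl) _).
refine (cvg_near_eq (@second_difference p v u l fl) _).
near=> h; congr (_ * l _).
by rewrite (addrAC p) !opprD addrACA.
Unshelve. all: by end_near. Qed.

End schwarz.
End smooth_theory.

(** * The weak inner product and curves on the Stiefel manifold *)

Section inner_theory.
Context {R : realType} {b : bool}.
Local Notation V := (V R b).
Local Notation V2 := (V * V)%type.
Implicit Types (f g h : V) (p q xi eta : V2).

(** The absolute value removes the sign [(-1) ^+ b], so periodic and antiperiodic functions are
    treated alike. *)
Lemma V_norm_period f t (n : nat) : `|f (t + n%:R * (2 * pi))| = `|f t|.
Proof.
elim: n => [|n IH]; first by rewrite mul0r addr0.
rewrite -natr1 mulrDl mul1r addrA V_period normrM IH.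
by rewrite normrX normrN1 expr1n mul1r.
Qed.

Lemma V_eq0 f : (forall t, 0 <= t <= 2 * pi -> f t = 0) -> f = 0.
Proof.
move=> f0; apply: val_inj; apply/funext => t /=.
have pi2 : 0 < 2 * pi :> R by rewrite mulr_gt0// pi_gt0.
(* [r] is the representative of [t] modulo the period that lies in the base interval. *)
pose m := Num.floor (t / (2 * pi)); pose r := t - m%:~R * (2 * pi).
have fr : f r = 0.
  apply: f0; rewrite /r subr_ge0 -ler_pdivlMr// floor_le /=.
  rewrite lerBlDr -[X in X + _]mul1r -mulrDl -ler_pdivrMr// addrC.
  by rewrite -[1]/(1%:~R) -intrD ltW// floorD1_gt.
apply/eqP; rewrite -normr_eq0; apply/eqP.
have -> : `|f t| = `|f r|; last by rewrite fr normr0.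
case: (intP m) @r {fr} => [|n|n] r.
- by rewrite /r mul0r subr0.
- by rewrite -(V_norm_period f r n.+1) /r subrK.
- by rewrite /r mulNr opprK -(V_norm_period f t n.+1).
Qed.

Lemma functional_derive1n (n : nat) (c t : R) : 0 <= t <= 2 * pi ->
  functional (fun f : V => c * derive1n n f t).
Proof.
move=> t2; split=> [a u v|f]; first by rewrite V_derive1nD V_derive1nZ mulrDr mulrCA.
have H : (fun g : V => derive1n n g t) @ nbhs f --> (derive1n n f t : R).
  apply/cvgrPdist_lt => e e0.
  by apply/V_nbhsP; exists n, e => // g; apply.
exact: (cvgM (cvg_cst c) H).
Qed.

(** The functionals are evaluations of derivatives of order at most [N], scaled by [2 / e] so that
    the polar condition reads as a bound by [e / 2]. Evaluations of order 0 already separate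
    points. *)
#[export] Instance polarized_V : polarized (V : tvsType R).
Proof.
split=> [U /V_nbhsP[N [e e0 HU]]|f H].
  have e20 : 0 < 2 / e by rewrite divr_gt0.
  exists [set l | exists n t, [/\ (n <= N)%N, 0 <= t <= 2 * pi &
    l = fun f : V => 2 / e * derive1n n f t]]; split.
  - by move=> _ [n [t [_ t2 ->]]]; exact: functional_derive1n.
  - apply/V_nbhsP; exists N, (e / 2); first by rewrite divr_gt0.
    move=> g fg _ [n [t [nN t2 ->]]]; have := fg n t nN t2.
    rewrite [derive1n n (0 : V)]derive1n_cst0 sub0r normrN => /ltW.
    by rewrite normrM gtr0_norm// -ler_pdivlMl// invf_div mulr1.
  - move=> g Hg; apply: HU => n t nN t2.
    rewrite [derive1n n (0 : V)]derive1n_cst0 sub0r normrN.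
    have := Hg _ (ex_intro _ n (ex_intro _ t (And3 nN t2 erefl))).
    rewrite normrM gtr0_norm// -ler_pdivlMl// invf_div mulr1 => /le_lt_trans; apply.
    by rewrite ltr_pdivrMr// ltr_pMr// ltr1n.
apply: V_eq0 => t t2; have := H _ (@functional_derive1n 0 1 t t2).
by rewrite mul1r.
Qed.

Lemma innerC f g : inner f g = inner g f.
Proof. by rewrite /inner; apply: eq_Rintegral => x _; rewrite mulrC. Qed.

Lemma innerDl f g h : inner (f + g) h = inner f h + inner g h.
Proof.
rewrite /inner -RintegralD//; [|exact: inner_integrable..].
by apply: eq_Rintegral => x _; rewrite -mulrDl.
Qed.

Lemma innerZl (a : R) f g : inner (a *: f) g = a * inner f g.
Proof.
rewrite /inner -RintegralZl//; last exact: inner_integrable.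
by apply: eq_Rintegral => x _; rewrite mulrA.
Qed.

Lemma innerDr f g h : inner f (g + h) = inner f g + inner f h.
Proof. by rewrite innerC innerDl !(innerC f). Qed.

Lemma innerZr (a : R) f g : inner f (a *: g) = a * inner f g.
Proof. by rewrite innerC innerZl innerC. Qed.

Lemma innerNl f g : inner (- f) g = - inner f g.
Proof. by rewrite -scaleN1r innerZl mulN1r. Qed.

Lemma innerNr f g : inner f (- g) = - inner f g.
Proof. by rewrite innerC innerNl innerC. Qed.

Definition innerE := (innerDl, innerDr, innerZl, innerZr, innerNl, innerNr).

Lemma inner_ge0 f : 0 <= inner f f.
Proof. by apply: Rintegral_ge0 => x _; rewrite -expr2 sqr_ge0. Qed.

Let mu2pi : fine (lebesgue_measure (`[0, 2 * pi] : set R)) = 2 * pi.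
Proof.
rewrite lebesgue_measure_itv/= lte_fin mulr_gt0 ?pi_gt0//.
by rewrite -EFinD/= subr0.
Qed.

Lemma inner_bound f g (A B : R) :
  (forall t, 0 <= t <= 2 * pi -> `|f t| <= A) ->
  (forall t, 0 <= t <= 2 * pi -> `|g t| <= B) ->
  `|inner f g| <= A * B * (2 * pi).
Proof.
move=> fA gB; rewrite ler_norml -mulNr.
have icst (c : R) : lebesgue_measure.-integrable `[0, 2 * pi]
    (EFin \o (fun _ : R => c)).
  apply: continuous_compact_integrable; first exact: segment_compact.
  by apply: continuous_subspaceT => x; exact: cvg_cst.
have H t : `[0, 2 * pi]%classic t -> `|f t * g t| <= A * B.
  by rewrite /= in_itv/= => t2; rewrite normrM ler_pM// ?fA ?gB.
rewrite -[2 * pi]mu2pi -!Rintegral_cst//; apply/andP; split.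
- apply: le_Rintegral => // [|t /H]; first exact: inner_integrable.
  by rewrite ler_norml => /andP[].
- apply: le_Rintegral => // [|t /H]; first exact: inner_integrable.
  by rewrite ler_norml => /andP[].
Qed.

Lemma inner_continuous : continuous (fun z : V2 => inner z.1 z.2 : R^o).
Proof.
move=> [f g]; apply/cvgrPdist_lt => e e0 /=.
have [M M0 HM] := V_bounded f 0; have [N N0 HN] := V_bounded g 0.
(* For [f'] and [g'] within [d <= 1] of [f] and [g], [f'] is bounded by [M + 1], and the two parts
   of the difference add up to at most [d * K]. *)
pose K := (M + N + 1) * (2 * pi).
have pi2 : 0 < 2 * pi :> R by rewrite mulr_gt0// pi_gt0.
have K0 : 0 < K by rewrite mulr_gt0// addr_gt0// addr_gt0.
pose d := Num.min 1 (e / 2 / K).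
have d0 : 0 < d by rewrite lt_min ltr01/= !divr_gt0.
have d1 : d <= 1 by rewrite ge_min lexx.
exists ([set h | Vclose 0 d f h], [set h | Vclose 0 d g h]) => /=.
  by split; apply/V_nbhsP; exists 0%N, d.
move=> [f' g'] [/= ff gg].
have -> : inner f g - inner f' g' = inner (f - f') g + inner f' (g - g').
  by rewrite !innerE addrA subrK.
apply: (@le_lt_trans _ _ (d * N * (2 * pi) + (M + 1) * d * (2 * pi))).
  rewrite (le_trans (ler_normD _ _))// lerD// inner_bound// => t t2.
  - exact/ltW/(ff 0%N).
  - exact: (HN 0%N).
  - rewrite -[f' t](subrK (f t)) addrC (le_trans (ler_normD _ _))// lerD//.
      exact: (HM 0%N).
    rewrite distrC; apply: le_trans d1; exact/ltW/(ff 0%N).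
  - exact/ltW/(gg 0%N).
have -> : d * N * (2 * pi) + (M + 1) * d * (2 * pi) = d * K by rewrite /K; ring.
rewrite (@le_lt_trans _ _ (e / 2))//; last by rewrite ltr_pdivrMr// ltr_pMr// ltr1n.
by rewrite -ler_pdivlMr// ge_min lexx orbT.
Qed.

Lemma inner_bilinear : bilinear_continuous (fun f g => inner f g : R^o).
Proof. by split; [move=> *; rewrite !innerE..|exact: inner_continuous]. Qed.

(** If [f c] were nonzero, continuity would keep the absolute value of [f] above half that of [f c]
    on an interval of positive length, making the integral of the square positive. *)
Lemma inner_eq0 f : inner f f = 0 -> f = 0.
Proof.
move=> ff0; apply: V_eq0 => c /andP[c0 c2]; apply/eqP/negPn/negP => fc0.
have pi2 : 0 < 2 * pi :> R by rewrite mulr_gt0// pi_gt0.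
have cf : {for c, continuous (f : R -> R)} by exact: (@V_continuous R b f 0).
have k0 : 0 < `|f c| / 2 by rewrite divr_gt0// normr_gt0.
have /cvgrPdist_lt/(_ _ k0)[d /= d0 Hd] := cf.
(* The closed interval of radius [d / 2] about [c], which fits in the open ball of radius [d],
   truncated to the period. It is nondegenerate even if [c] is an endpoint. *)
pose x := Num.max 0 (c - d / 2); pose y := Num.min (2 * pi) (c + d / 2).
have xc : x <= c by rewrite ge_max c0 lerBlDr lerDl ltW// divr_gt0.
have cy : c <= y by rewrite le_min c2 lerDl ltW// divr_gt0.
have xy : x < y.
  have [cl|cg] := ltP c (2 * pi).
    by rewrite (le_lt_trans xc)// lt_min cl ltrDl divr_gt0.
  rewrite (lt_le_trans _ cy)// gt_max (lt_le_trans pi2 cg) ltrBlDr ltrDl.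
  by rewrite divr_gt0.
pose k := (`|f c| / 2) ^+ 2.
have kf t : `[x, y]%classic t -> k <= f t * f t.
  rewrite /= in_itv/= => /andP[xt ty]; rewrite -expr2 -[leRHS]real_normK ?num_real//.
  rewrite ler_pXn2r ?nnegrE ?normr_ge0 ?(ltW k0)//.
  have ct : `|c - t| < d.
    apply: (@le_lt_trans _ _ (d / 2)); last by rewrite ltr_pdivrMr// ltr_pMr// ltr1n.
    move: xt ty; rewrite ge_max le_min => /andP[_ xt] /andP[_ ty].
    by rewrite ler_distlC xt.
  have fct := Hd t ct.
  have : `|f c| <= `|f c - f t| + `|f t|.
    by rewrite -{1}[f c](subrK (f t)) ler_normD.
  move=> H1; move: fct H1 k0 => /=; lra.
have xyI : `[x, y] `<=` (`[0, 2 * pi]%classic : set R).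
  apply: subset_itv; rewrite bnd_simp; first by rewrite le_max lexx.
  by rewrite ge_min lexx.
suff : 0 < inner f f by rewrite ff0 ltxx.
have ixy : lebesgue_measure.-integrable `[x, y] (EFin \o (fun t => f t * f t)).
  by apply: integrableS (inner_integrable f f).
apply: (@lt_le_trans _ _ (\int[lebesgue_measure]_(t in `[x, y]) (f t * f t))).
  apply: (@lt_le_trans _ _ (\int[lebesgue_measure]_(t in `[x, y]) k)).
    have muxy : fine (lebesgue_measure (`[x, y] : set R)) = y - x.
      by rewrite lebesgue_measure_itv/= lte_fin xy -EFinD.
    rewrite Rintegral_cst//.
    by rewrite [X in _ * X]muxy mulr_gt0 ?exprn_gt0 ?subr_gt0.
  apply: le_Rintegral => //.
  apply: continuous_compact_integrable; first exact: segment_compact.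
  by apply: continuous_subspaceT => z; exact: cvg_cst.
rewrite /inner /Rintegral fine_le//.
- exact: integrable_fin_num.
- by apply: integrable_fin_num => //; exact: inner_integrable.
- apply: ge0_subset_integral => //.
  + by have /integrableP[] := inner_integrable f f.
  + by move=> t _; rewrite lee_fin -expr2 sqr_ge0.
Qed.

Lemma inner2_eq0 xi : inner2 xi xi = 0 -> xi = 0.
Proof.
case: xi => u v; rewrite /inner2/= => /eqP.
rewrite paddr_eq0 ?inner_ge0// => /andP[/eqP/inner_eq0 -> /eqP/inner_eq0 ->].
by [].
Qed.

Lemma inner2C xi eta : inner2 xi eta = inner2 eta xi.
Proof. by rewrite /inner2 innerC (innerC xi.2). Qed.

Lemma inner2Dl xi xi' eta : inner2 (xi + xi') eta = inner2 xi eta + inner2 xi' eta.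
Proof. by rewrite /inner2 /= !innerE addrACA. Qed.

Lemma inner2Nl xi eta : inner2 (- xi) eta = - inner2 xi eta.
Proof. by rewrite /inner2 /= !innerE -opprD. Qed.

Lemma inner2Bl xi xi' eta : inner2 (xi - xi') eta = inner2 xi eta - inner2 xi' eta.
Proof. by rewrite inner2Dl inner2Nl. Qed.

End inner_theory.

(** * Curves on the Stiefel manifold with prescribed velocity *)

Section stiefel_curve.
Context {R : realType} {b : bool}.
Local Notation V := (V R b).
Local Notation V2 := (V * V)%type.
Implicit Types (p q xi eta : V2).

(* [h *: w h] is the Gram-Schmidt correction of [h *: xi]; with
   [mu x = (1 / sqrt x - 1) / (x - 1)], extended continuously to [x = 1], the
   quotient by [h] needs no limit. *)
Lemma stiefel_curve p xi : stiefel p -> tangent p xi ->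
  exists2 w : R -> V2, w @ 0^' --> xi &
    \forall h \near (0 : R)^', stiefel (p + h *: w h).
Proof.
case: p xi => e f [a c] [/= ee ff ef] [/= ea fc eafc].
pose A := inner a a; pose B := inner c c; pose C := inner a c.
pose rs (x : R) := (Num.sqrt x)^-1.
pose mu (x : R) := - (Num.sqrt x * (1 + Num.sqrt x))^-1.
have rsmu x : 0 < x -> (x - 1) * mu x = rs x - 1.
  move=> x0; rewrite /mu /rs -[X in X - 1](sqr_sqrtr (ltW x0)).
  have s0 : 0 < Num.sqrt x by rewrite sqrtr_gt0.
  by field; rewrite !gt_eqF// addr_gt0.
have rs2 x : 0 < x -> rs x ^+ 2 * x = 1.
  by move=> x0; rewrite /rs exprVn sqr_sqrtr ?ltW// mulVf// gt_eqF.
(* [G1 h] is the squared norm of [e + h *: a]. By tangency the inner product of [e + h *: a] and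
   [f + h *: c] is [h ^+ 2 * C], so adding [h * ka h] times the former to the latter makes them
   orthogonal; [G2 h] is the squared norm of the result. *)
pose G1 (h : R) := 1 + h * (h * A).
pose ka h := - (h * C) / G1 h.
pose G2 h := 1 + h * (h * B + h * h * ka h * C).
have h0 : (fun h : R => h) @ (0 : R)^' --> (0 : R) by apply: cvg_within.
have G1c : G1 @ (0 : R)^' --> (1 : R).
  rewrite -[X in _ --> X]addr0 -[X in _ --> _ + X](mul0r (0 * A)).
  exact: (cvgD (cvg_cst _) (cvgM h0 (cvgM h0 (cvg_cst A)))).
have kac : ka @ (0 : R)^' --> (0 : R).
  rewrite -[X in _ --> X](mul0r (1^-1 : R)); apply: cvgM;
    last exact: (cvgV (oner_neq0 _) G1c).
  rewrite -[X in _ --> X]oppr0 -[X in _ --> - X](mul0r C); apply: cvgN.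
  exact: (cvgM h0 (cvg_cst C)).
have G2c : G2 @ (0 : R)^' --> (1 : R).
  rewrite -[X in _ --> X]addr0 -[X in _ --> _ + X](mul0r (0 * B + 0 * 0 * 0 * C)).
  exact: (cvgD (cvg_cst _) (cvgM h0 (cvgD (cvgM h0 (cvg_cst B))
    (cvgM (cvgM (cvgM h0 h0) kac) (cvg_cst C))))).
have sqc (G : R -> R) : G @ (0 : R)^' --> (1 : R) ->
    (fun h => Num.sqrt (G h)) @ (0 : R)^' --> (1 : R).
  by move=> Gc; rewrite -[X in _ --> X]sqrtr1; apply: (cvg_comp _ _ Gc);
    exact: sqrt_continuous.
have rsc (G : R -> R) : G @ (0 : R)^' --> (1 : R) ->
    (fun h => rs (G h)) @ (0 : R)^' --> (1 : R).
  move=> /sqc Gc; rewrite -[X in _ --> X]invr1.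
  exact: (cvgV (oner_neq0 _) Gc).
have muc (G : R -> R) : G @ (0 : R)^' --> (1 : R) ->
    (fun h => mu (G h)) @ (0 : R)^' --> (- (1 * (1 + 1))^-1 : R).
  move=> /sqc Gc; apply: cvgN.
  have n0 : 1 * (1 + 1) != 0 :> R by rewrite mul1r gt_eqF// addr_gt0.
  exact: (cvgV n0 (cvgM Gc (cvgD (cvg_cst _) Gc))).
(* [s] and [r] are the changes of the normalising factors from 1, divided by [h], as [hs] and [hr]
   state below. *)
pose s h := h * A * mu (G1 h).
pose r h := (h * B + h * h * ka h * C) * mu (G2 h).
have sc : s @ (0 : R)^' --> (0 : R).
  have e0 : 0 * A * - (1 * (1 + 1))^-1 = 0 :> R by rewrite !mul0r.
  rewrite -[X in _ --> X]e0.
  exact: (cvgM (cvgM h0 (cvg_cst A)) (muc _ G1c)).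
have rc : r @ (0 : R)^' --> (0 : R).
  have e0 : (0 * B + 0 * 0 * 0 * C) * - (1 * (1 + 1))^-1 = 0 :> R.
    by rewrite !mul0r addr0 mul0r.
  rewrite -[X in _ --> X]e0.
  exact: (cvgM (cvgD (cvgM h0 (cvg_cst B))
    (cvgM (cvgM (cvgM h0 h0) kac) (cvg_cst C))) (muc _ G2c)).
exists (fun h => (rs (G1 h) *: a + s h *: e,
    rs (G2 h) *: c + r h *: f + (rs (G2 h) * ka h) *: (e + h *: a))).
  have -> : nbhs (a, c) = nbhs ((1 : R) *: a + (0 : R) *: e,
      (1 : R) *: c + (0 : R) *: f + (1 * 0 : R) *: (e + (0 : R) *: a)).
    by rewrite mul1r !scale0r !addr0 !scale1r.
  refine (cvg_pair
    (tvs_cvgD (tvs_cvgZ (rsc _ G1c) (cvg_cst a)) (tvs_cvgZ sc (cvg_cst e)))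
    (tvs_cvgD (tvs_cvgD (tvs_cvgZ (rsc _ G2c) (cvg_cst c)) (tvs_cvgZ rc (cvg_cst f)))
      (tvs_cvgZ (cvgM (rsc _ G2c) kac)
        (tvs_cvgD (cvg_cst e) (tvs_cvgZ h0 (cvg_cst a)))))).
near=> h.
have G1p : 0 < G1 h by near: h; apply: (cvgr_gt _ G1c); exact: ltr01.
have G2p : 0 < G2 h by near: h; apply: (cvgr_gt _ G2c); exact: ltr01.
have hs : h * s h = rs (G1 h) - 1 by rewrite -rsmu// /s /G1; ring.
have hr : h * r h = rs (G2 h) - 1 by rewrite -rsmu// /r {2}/G2; ring.
have hka : ka h * G1 h = - (h * C) by rewrite /ka mulfVK// gt_eqF.
have E1 := rs2 _ G1p; have E2 := rs2 _ G2p.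
have ae : inner a e = 0 by rewrite innerC.
have cf : inner c f = 0 by rewrite innerC.
have fe : inner f e = 0 by rewrite innerC.
have ca : inner c a = C by rewrite innerC.
have ec : inner e c = - inner f a by apply/eqP; rewrite -addr_eq0; apply/eqP.
have ce : inner c e = - inner f a by rewrite innerC.
have af : inner a f = inner f a by rewrite innerC.
split; rewrite /= !innerE ?(ee, ff, ef, ea, fc, ae, cf, fe, ca, ec, ce, af)
  -/A -/B -/C.
(* Each of the three orthonormality equations is a polynomial identity once [hs], [hr], [hka] and
   the normalisations [E1], [E2] are substituted. *)
- transitivity ((1 + h * s h) ^+ 2 + h * (h * A) * rs (G1 h) ^+ 2); first by ring.
  by rewrite hs subrKC -[RHS]E1 /G1; ring.
- move: (rs (G1 h)) (rs (G2 h)) hs hr E1 E2 => P Q hs hr E1 E2.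
  transitivity ((1 + h * r h) ^+ 2 + h ^+ 2 * Q ^+ 2 * B +
    h ^+ 2 * Q ^+ 2 * ka h * (ka h * (1 + h * (h * A))) +
    2 * (1 + h * r h) * h ^+ 2 * Q * ka h * inner f a +
    2 * h ^+ 2 * Q ^+ 2 * ka h * (h * C - inner f a)); first by ring.
  by rewrite hr subrKC -/(G1 h) hka -[RHS]E2 /G2; ring.
- move: (rs (G1 h)) (rs (G2 h)) hs hr E1 E2 => P Q hs hr E1 E2.
  transitivity ((1 + h * r h) * (h * P * inner f a)
    - h * Q * inner f a * (1 + h * s h) + h * P * (h * Q * C)
    + h * Q * ka h * (1 + h * s h) + h * Q * ka h * h * (h * P * A)).
    by ring.
  rewrite hs hr !subrKC.
  transitivity (P * Q * h * (h * C + ka h * (1 + h * (h * A)))); first by ring.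
  by rewrite -/(G1 h) hka subrr mulr0.
Unshelve. all: by end_near. Qed.

(** Along the curve of [stiefel_curve] the quotients of [g] and [g'] coincide, and [C1_strict]
    identifies their limits. Tangential derivatives therefore do not depend on the chosen
    extension. *)
Lemma gateaux_stiefel (F : tvsType R) {pF : polarized F} (g g' : V2 -> F) p xi :
  C1 g -> C1 g' -> (forall q, stiefel q -> g q = g' q) ->
  stiefel p -> tangent p xi -> gateaux g p xi = gateaux g' p xi.
Proof.
move=> Cg Cg' gg' sp txi; have [w wxi sw] := stiefel_curve sp txi.
refine (polarized_unique (C1_strict Cg (cvg_cst p) wxi) _).
refine (cvg_near_eq (C1_strict Cg' (cvg_cst p) wxi) _).
by near=> h; rewrite !gg'//; near: h.
Unshelve. all: by end_near. Qed.

End stiefel_curve.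

(** * The Levi-Civita connection and its curvature *)

Section levi_civita.
Context {R : realType} {b : bool}.
Local Notation V := (V R b).
Local Notation V2 := (V * V)%type.
Implicit Types (p q v xi eta : V2) (X Y Z : V2 -> V2).

Lemma VfunD (f g : V) t : (f + g) t = f t + g t.
Proof. exact: (V_derive1nD f g 0). Qed.

Lemma VfunZ (a : R) (f : V) t : (a *: f) t = a * f t.
Proof. exact: (V_derive1nZ a f 0). Qed.

Lemma V_ext (f g : V) : (forall t, f t = g t) -> f = g.
Proof. by move=> fg; apply: val_inj; apply/funext. Qed.

Lemma VfunN (f : V) t : (- f) t = - f t.
Proof. by rewrite -scaleN1r VfunZ mulN1r. Qed.

(* Minus the second fundamental form of [stiefel] at [p], extended to a trilinear
   map on all of [V * V] so that no retraction onto [stiefel] is needed. *)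
Definition lc_normal p xi eta : V2 :=
  (inner xi.1 eta.1 *: p.1 + (inner xi.1 eta.2 + inner xi.2 eta.1) / 2 *: p.2,
   inner xi.2 eta.2 *: p.2 + (inner xi.1 eta.2 + inner xi.2 eta.1) / 2 *: p.1).

Lemma lc_normalC p xi eta : lc_normal p xi eta = lc_normal p eta xi.
Proof.
rewrite /lc_normal (innerC xi.1 eta.1) (innerC xi.2 eta.2) (innerC xi.1 eta.2).
by rewrite (innerC xi.2 eta.1) [inner _ _ + inner _ _]addrC.
Qed.

Lemma lc_normalDr p xi eta eta' :
  lc_normal p xi (eta + eta') = lc_normal p xi eta + lc_normal p xi eta'.
Proof.
by congr pair; apply: V_ext => t;
  rewrite !(VfunD, VfunZ) /= !innerE; ring.
Qed.

Lemma lc_normalZr p xi (k : R) eta :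
  lc_normal p xi (k *: eta) = k *: lc_normal p xi eta.
Proof.
by congr pair; apply: V_ext => t;
  rewrite !(VfunD, VfunZ) /= !innerE; ring.
Qed.

Lemma inner2_lc_normal p xi eta v : inner2 (lc_normal p xi eta) v =
  inner xi.1 eta.1 * inner p.1 v.1 + inner xi.2 eta.2 * inner p.2 v.2 +
  (inner xi.1 eta.2 + inner xi.2 eta.1) / 2 * (inner p.1 v.2 + inner p.2 v.1).
Proof. by rewrite /inner2 /= !innerE; ring. Qed.

Lemma lc_normal_perp p xi eta v : tangent p v ->
  inner2 (lc_normal p xi eta) v = 0.
Proof.
by move=> [v1 v2 v12]; rewrite inner2_lc_normal v1 v2 v12 !mulr0 !addr0.
Qed.

Lemma innerr0 (f : V) : inner f 0 = 0.
Proof. by rewrite -(scale0r (0 : V)) innerZr mul0r. Qed.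

Lemma inner2r0 xi : inner2 xi 0 = 0.
Proof. by rewrite /inner2 !innerr0 addr0. Qed.

Lemma tangentB p xi eta : tangent p xi -> tangent p eta -> tangent p (xi - eta).
Proof.
move=> [x1 x2 x12] [y1 y2 y12]; split; rewrite /= !innerE.
- by rewrite x1 y1 subrr.
- by rewrite x2 y2 subrr.
- by rewrite addrACA -opprD x12 y12 subrr.
Qed.

Lemma smooth_inner (X Y : V2 -> V) : smooth X -> smooth Y ->
  smooth (fun q => inner (X q) (Y q) : R^o).
Proof. exact: smooth_bilinear inner_bilinear. Qed.

Lemma smooth_lc_coef X Y : smooth X -> smooth Y ->
  smooth (fun q => (inner (X q).1 (Y q).2 + inner (X q).2 (Y q).1) / 2 : R^o).
Proof.
move=> sX sY.
have -> : (fun q => (inner (X q).1 (Y q).2 + inner (X q).2 (Y q).1) / 2 : R^o) =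
    (fun q => (2^-1 : R^o) *:
      ((inner (X q).1 (Y q).2 : R^o) + inner (X q).2 (Y q).1)).
  by apply/funext => q; rewrite mulrC.
exact (smoothZ (smooth_cst _ _)
  (smoothD (smooth_inner (smooth_fst sX) (smooth_snd sY))
           (smooth_inner (smooth_snd sX) (smooth_fst sY)))).
Qed.

Lemma smooth_lc_normal X Y Z : smooth X -> smooth Y -> smooth Z ->
  smooth (fun q => lc_normal (X q) (Y q) (Z q)).
Proof.
move=> sX sY sZ.
pose proof (smooth_fst sX) as X1; pose proof (smooth_snd sX) as X2.
pose proof (smooth_fst sY) as Y1; pose proof (smooth_snd sY) as Y2.
pose proof (smooth_fst sZ) as Z1; pose proof (smooth_snd sZ) as Z2.
pose proof (smooth_lc_coef sY sZ) as c12.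
exact (smooth_pair
  (smoothD (smoothZ (smooth_inner Y1 Z1) X1) (smoothZ c12 X2))
  (smoothD (smoothZ (smooth_inner Y2 Z2) X2) (smoothZ c12 X1))).
Qed.

(** At points of [stiefel] this is the orthogonal projection of [xi] to the tangent space:
    [(q.1, 0)], [(0, q.2)], [(q.2, q.1)] are orthogonal with squared norms 1, 1, 2, which explains
    the halved mixed coefficient. Being polynomial in [q], it extends a given tangent vector to a
    smooth field. *)
Definition proj_field xi : V2 -> V2 := fun q => xi - lc_normal q q xi.

Lemma proj_field_eq p xi : tangent p xi -> proj_field xi p = xi.
Proof.
move=> [x1 x2 x12]; rewrite /proj_field /lc_normal x1 x2 x12 mul0r !scale0r !addr0.
exact: subr0.
Qed.

Lemma vector_field_proj xi : vector_field (proj_field xi).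
Proof.
split.
  apply: smoothD; first exact: smooth_cst.
  by apply: smoothN; apply: smooth_lc_normal; [exact: smooth_id..|exact: smooth_cst].
move=> [e f] [/= ee ff ef]; have fe : inner f e = 0 by rewrite innerC.
by split; rewrite /= !innerE ?(ee, ff, ef, fe); field.
Qed.

(** For vector fields at points of [stiefel] this is the tangential projection of [D_X Y], since
    [tangent_gateaux] shows the normal part of [D_X Y] to be the opposite of [lc_normal]. *)
Definition lc_connection X Y : V2 -> V2 :=
  fun p => gateaux Y p (X p) + lc_normal p (X p) (Y p).

Lemma smooth_gateaux_field X Y : smooth X -> smooth Y ->
  smooth (fun p => gateaux Y p (X p)).
Proof.
move=> sX sY.
exact (smooth_comp (smooth_pair (@smooth_id _ _ _) sX) (smooth_dgateaux sY)).
Qed.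

Lemma gateaux_inner (X Y : V2 -> V) p v : C1 X -> C1 Y ->
  gateaux (fun q => inner (X q) (Y q) : R^o) p v =
  inner (gateaux X p v) (Y p) + inner (X p) (gateaux Y p v).
Proof. exact: (gateaux_bilinear p v inner_bilinear). Qed.

Lemma inner2_bilinear : bilinear_continuous (fun xi eta => inner2 xi eta : R^o).
Proof.
split=> [y a u v|x a u v|z].
- by rewrite /inner2 /= !innerE addrACA -mulrDr.
- by rewrite /inner2 /= !innerE addrACA -mulrDr.
have c11 : continuous (fun z : V2 * V2 => inner z.1.1 z.2.1 : R^o).
  move=> u; refine (bilinear_cvg inner_bilinear _ _).
  - exact: (cvg_comp fst fst cvg_fst cvg_fst).
  - exact: (cvg_comp snd fst cvg_snd cvg_fst).
have c22 : continuous (fun z : V2 * V2 => inner z.1.2 z.2.2 : R^o).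
  move=> u; refine (bilinear_cvg inner_bilinear _ _).
  - exact: (cvg_comp fst snd cvg_fst cvg_snd).
  - exact: (cvg_comp snd snd cvg_snd cvg_snd).
exact (tvs_cvgD (@c11 z) (@c22 z)).
Qed.

Lemma gateaux_inner2 X Y p v : C1 X -> C1 Y ->
  gateaux (fun q => inner2 (X q) (Y q) : R^o) p v =
  inner2 (gateaux X p v) (Y p) + inner2 (X p) (gateaux Y p v).
Proof. exact: (gateaux_bilinear p v inner2_bilinear). Qed.

(* Differentiating the equations that say that [Y] is tangent. *)
Lemma tangent_gateaux p xi Y : stiefel p -> tangent p xi -> vector_field Y ->
  [/\ inner p.1 (gateaux Y p xi).1 = - inner xi.1 (Y p).1,
      inner p.2 (gateaux Y p xi).2 = - inner xi.2 (Y p).2 &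
      inner p.1 (gateaux Y p xi).2 + inner p.2 (gateaux Y p xi).1 =
      - (inner xi.1 (Y p).2 + inner xi.2 (Y p).1)].
Proof.
move=> sp tx [sY tY].
have sid : smooth (fun q : V2 => q) by exact: smooth_id.
pose proof (smooth_fst sid) as i1; pose proof (smooth_snd sid) as i2.
pose proof (smooth_fst sY) as Y1; pose proof (smooth_snd sY) as Y2.
pose proof (smooth_C1 sY) as C1Y; pose proof (smooth_C1 sid) as C1i.
(* On [stiefel], [g] agrees with the zero function, so [gateaux_stiefel] applies. *)
have key (g : V2 -> R^o) : smooth g -> (forall q, stiefel q -> g q = 0) ->
    gateaux g p xi = 0.
  move=> sg g0; rewrite (gateaux_stiefel (g' := fun=> 0) (smooth_C1 sg) _ g0 sp tx).
    exact: gateaux_cst.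
  by apply: smooth_C1; exact: smooth_cst.
have gi (A B : V2 -> V) : smooth A -> smooth B ->
    gateaux (fun q => inner (A q) (B q) : R^o) p xi =
    inner (gateaux A p xi) (B p) + inner (A p) (gateaux B p xi).
  by move=> sA sB; apply: gateaux_inner; exact: smooth_C1.
pose proof (key _ (smooth_inner i1 Y1)
  (fun q sq => let: And3 h _ _ := tY q sq in h)) as E1.
pose proof (key _ (smooth_inner i2 Y2)
  (fun q sq => let: And3 _ h _ := tY q sq in h)) as E2.
pose proof (key _ (smoothD (smooth_inner i1 Y2) (smooth_inner i2 Y1))
  (fun q sq => let: And3 _ _ h := tY q sq in h)) as E3.
move: E1 E2 E3; rewrite gateauxD; [|by apply: smooth_C1; exact: smooth_inner..].
rewrite !gi// !gateaux_fst// !gateaux_snd// !gateaux_id.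
move=> /eqP; rewrite addrC addr_eq0 => /eqP E1.
move=> /eqP; rewrite addrC addr_eq0 => /eqP E2 E3; split => //.
by apply/eqP; rewrite -addr_eq0; apply/eqP; rewrite -[RHS]E3; ring.
Qed.

Lemma vector_field_lc X Y : vector_field X -> vector_field Y ->
  vector_field (lc_connection X Y).
Proof.
move=> vX vY; split.
  apply: smoothD; first exact: (smooth_gateaux_field vX.1 vY.1).
  exact: (smooth_lc_normal (@smooth_id _ _ _) vX.1 vY.1).
move=> p sp; have [E1 E2 E3] := tangent_gateaux sp (vX.2 p sp) vY.
case: (sp) => ee ff ef; have fe : inner p.2 p.1 = 0 by rewrite innerC.
split; rewrite /= !innerE ?(ee, ff, ef, fe, E1, E2); try ring.
by rewrite addrACA E3; field.
Qed.

(** Vanishing torsion comes from the symmetry of [lc_normal], compatibility with the metric from its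
    orthogonality to tangent vectors, and independence of extensions from [gateaux_stiefel]. *)
Lemma lc_connection_is_levi_civita : is_levi_civita lc_connection.
Proof.
split.
- exact: vector_field_lc.
- move=> X X' Y Y' [sX tX] vX' [sY tY] [sY' tY'] XX' YY' p sp.
  have E2 : lc_normal p (X p) (Y p) = lc_normal p (X' p) (Y' p).
    by rewrite (XX' p sp) (YY' p sp).
  have E1 : gateaux Y p (X p) = gateaux Y' p (X' p).
    rewrite (XX' p sp).
    exact (gateaux_stiefel (smooth_C1 sY) (smooth_C1 sY') YY' sp (vX'.2 p sp)).
  by rewrite /lc_connection E1 E2.
- move=> X X' Y vX vX' vY p sp; rewrite /lc_connection.
  rewrite (gateauxD_dir _ _ _ (smooth_C1 vY.1)) addrACA; congr (_ + _).
  by rewrite !(lc_normalC _ _ (Y p)) lc_normalDr.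
- move=> g X Y sg vX vY p sp; rewrite /lc_connection.
  rewrite (gateauxZ_dir _ _ _ (smooth_C1 vY.1)) scalerDr; congr (_ + _).
  by rewrite !(lc_normalC _ _ (Y p)) lc_normalZr.
- move=> X Y Y' vX vY vY' p sp; rewrite /lc_connection lc_normalDr addrACA.
  by rewrite (gateauxD _ _ (smooth_C1 vY.1) (smooth_C1 vY'.1)).
- move=> g X Y sg vX vY p sp; rewrite /lc_connection lc_normalZr scalerDr addrA.
  by rewrite (gateauxZ _ _ (smooth_C1 sg) (smooth_C1 vY.1)).
- move=> X Y vX vY p sp; rewrite /lc_connection (lc_normalC _ (Y p)).
  have E (W : zmodType) (x y n : W) : x + n - (y + n) = x - y.
    by rewrite opprD addrACA subrr addr0.
  exact (E _ _ _ _).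
- move=> X Y Z vX vY vZ p sp; rewrite /lc_connection.
  rewrite gateaux_inner2; [|exact: smooth_C1 vY.1|exact: smooth_C1 vZ.1].
  rewrite inner2Dl (inner2C (Y p) (_ + _)) inner2Dl.
  rewrite (lc_normal_perp _ _ (vZ.2 p sp)) (lc_normal_perp _ _ (vY.2 p sp)) !addr0.
  exact (congr1 (+%R (inner2 (gateaux Y p (X p)) (Z p))) (inner2C _ _)).
Qed.

(** The difference [S] is symmetric by vanishing torsion and skew in its last two slots by the
    metric condition, hence orthogonal to all fields. As [S X Y] is itself tangent, it is the value
    of some field, and definiteness of the weak inner product gives zero. *)
Lemma levi_civita_unique nabla nabla' X Y p :
  is_levi_civita nabla -> is_levi_civita nabla' ->
  vector_field X -> vector_field Y -> stiefel p ->
  nabla X Y p = nabla' X Y p.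
Proof.
move=> LN LN' vX vY sp.
have [S SE] : exists S, forall X Y, S X Y = nabla X Y p - nabla' X Y p.
  by exists (fun X Y => nabla X Y p - nabla' X Y p).
have SC X0 Y0 : vector_field X0 -> vector_field Y0 -> S X0 Y0 = S Y0 X0.
  have E (W : zmodType) (x y x' y' : W) : x - y = x' - y' -> x - x' = y - y'.
    by move=> xy; rewrite -[x](subrK y) xy addrAC (addrAC x') subrr add0r addrC.
  move=> vX0 vY0; rewrite !SE; apply: E.
  exact: etrans (lc_torsion_free LN vX0 vY0 sp) (esym (lc_torsion_free LN' vX0 vY0 sp)).
have SA X0 Y0 Z0 : vector_field X0 -> vector_field Y0 -> vector_field Z0 ->
    inner2 (S X0 Y0) (Z0 p) = - inner2 (S X0 Z0) (Y0 p).
  move=> vX0 vY0 vZ0; have := lc_metric LN vX0 vY0 vZ0 sp.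
  rewrite (lc_metric LN' vX0 vY0 vZ0 sp) !SE !inner2Bl !(inner2C (Y0 p)).
  move: (inner2 (nabla X0 Y0 p) _) (inner2 (nabla' X0 Y0 p) _).
  move: (inner2 (nabla X0 Z0 p) _) (inner2 (nabla' X0 Z0 p) _) => x y z t; lra.
have S0 Z : vector_field Z -> inner2 (S X Y) (Z p) = 0.
  move=> vZ.
  (* Three skew exchanges alternating with three symmetric ones return to the start with the
     opposite sign. *)
  have : inner2 (S X Y) (Z p) = - inner2 (S X Y) (Z p).
    rewrite {1}(SA X Y Z vX vY vZ) (SC X Z vX vZ) (SA Z X Y vZ vX vY) opprK.
    by rewrite (SC Z Y vZ vY) (SA Y Z X vY vZ vX) (SC Y X vY vX).
  by move: (inner2 (S X Y) (Z p)) => x; lra.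
have tS : tangent p (S X Y).
  rewrite SE; apply: tangentB.
  - exact: (lc_field LN vX vY).2.
  - exact: (lc_field LN' vX vY).2.
have := S0 _ (vector_field_proj (S X Y)).
rewrite (proj_field_eq tS) => /inner2_eq0; rewrite SE.
exact: subr0_eq.
Qed.

(** Tangency comes from vanishing torsion: on [stiefel] the bracket is a difference of two covariant
    derivatives. *)
Lemma vector_field_lie_bracket X Y : vector_field X -> vector_field Y ->
  vector_field (lie_bracket X Y).
Proof.
move=> vX vY; split.
  apply: smoothD; first exact: (smooth_gateaux_field vX.1 vY.1).
  by apply: smoothN; exact: (smooth_gateaux_field vY.1 vX.1).
move=> p sp; rewrite -(lc_torsion_free lc_connection_is_levi_civita)//.
by apply: tangentB; [exact: (vector_field_lc vX vY).2|exact: (vector_field_lc vY vX).2].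
Qed.

Lemma riemann_unique nabla nabla' X Y Z p :
  is_levi_civita nabla -> is_levi_civita nabla' ->
  vector_field X -> vector_field Y -> vector_field Z -> stiefel p ->
  riemann nabla X Y Z p = riemann nabla' X Y Z p.
Proof.
move=> LN LN' vX vY vZ sp; rewrite /riemann.
(* The inner derivatives [nabla B Z] and [nabla' B Z] are known to agree on [stiefel] only, so
   [lc_ext] is what lets the outer derivative be compared. *)
have E A B : vector_field A -> vector_field B ->
    nabla A (nabla B Z) p = nabla' A (nabla' B Z) p.
  move=> vA vB; rewrite (levi_civita_unique LN LN' vA (lc_field LN vB vZ) sp).
  exact (lc_ext LN' vA vA (lc_field LN vB vZ) (lc_field LN' vB vZ)
    (fun _ _ => erefl) (fun q sq => levi_civita_unique LN LN' vB vZ sq) sp).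
rewrite (E X Y vX vY) (E Y X vY vX).
by rewrite (levi_civita_unique LN LN' (vector_field_lie_bracket vX vY) vZ sp).
Qed.

(** Terms that differentiate the coefficients remain multiples of the normal vectors at [p], which
    pair to zero with [xi]; only the derivative of the base point survives. *)
Lemma gateaux_lc_normal X Y p v xi : smooth X -> smooth Y -> tangent p xi ->
  inner2 (gateaux (fun q => lc_normal q (X q) (Y q)) p v) xi =
  inner2 (lc_normal v (X p) (Y p)) xi.
Proof.
move=> sX sY [x1 x2 x12].
have sid : smooth (fun q : V2 => q) by exact: smooth_id.
pose proof (smooth_fst sid) as i1; pose proof (smooth_snd sid) as i2.
pose proof (smooth_fst sX) as X1; pose proof (smooth_snd sX) as X2.
pose proof (smooth_fst sY) as Y1; pose proof (smooth_snd sY) as Y2.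
pose proof (smooth_C1 sid) as C1i.
pose proof (smooth_lc_normal sid sX sY) as sN.
have Ccst (c : V2) : C1 (fun _ : V2 => c) by apply: smooth_C1; exact: smooth_cst.
have scst (c : V) : smooth (fun _ : V2 => c) by exact: smooth_cst.
have := gateaux_inner2 p v (smooth_C1 sN) (Ccst xi).
rewrite gateaux_cst inner2r0 addr0 => <-.
under eq_fun do rewrite inner2_lc_normal.
have prod0 (u l : V2 -> R^o) : smooth u -> smooth l -> l p = 0 ->
    gateaux (fun q => u q *: l q : R^o) p v = u p * gateaux l p v.
  move=> su sl l0; rewrite [LHS](gateauxZ _ _ (smooth_C1 su) (smooth_C1 sl)) l0.
  by rewrite scaler0 add0r.
have L (i : V2 -> V) (c : V) : smooth i ->
    gateaux (fun q => inner (i q) c : R^o) p v = inner (gateaux i p v) c.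
  move=> si; rewrite (gateaux_inner _ _ (smooth_C1 si) (smooth_C1 (scst c))).
  by rewrite gateaux_cst innerr0 addr0.
have sL (i : V2 -> V) (c : V) : smooth i -> smooth (fun q => inner (i q) c : R^o).
  by move=> si; exact: smooth_inner.
pose proof (smooth_lc_coef sX sY) as sc.
pose proof (smoothZ (smooth_inner X1 Y1) (sL _ xi.1 i1)) as s1.
pose proof (smoothZ (smooth_inner X2 Y2) (sL _ xi.2 i2)) as s2.
pose proof (smoothZ sc (smoothD (sL _ xi.2 i1) (sL _ xi.1 i2))) as s3.
rewrite (gateauxD _ _ (smooth_C1 (smoothD s1 s2)) (smooth_C1 s3)).
rewrite (gateauxD _ _ (smooth_C1 s1) (smooth_C1 s2)).
pose proof (P1 := prod0 _ _ (smooth_inner X1 Y1) (sL _ xi.1 i1) x1).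
pose proof (P2 := prod0 _ _ (smooth_inner X2 Y2) (sL _ xi.2 i2) x2).
pose proof (P3 := prod0 _ _ sc (smoothD (sL _ xi.2 i1) (sL _ xi.1 i2)) x12).
rewrite P1 P2 P3.
rewrite (gateauxD _ _ (smooth_C1 (sL _ xi.2 i1)) (smooth_C1 (sL _ xi.1 i2))).
rewrite (L _ xi.1 i1) (L _ xi.2 i2) (L _ xi.2 i1) (L _ xi.1 i2).
by rewrite (gateaux_fst _ _ C1i) (gateaux_snd _ _ C1i) gateaux_id inner2_lc_normal.
Qed.

Lemma gateaux_dgateaux_snd Y p v w : smooth Y ->
  gateaux (fun pv : V2 * V2 => gateaux Y pv.1 pv.2) (p, v) (0, w) = gateaux Y p w.
Proof.
move=> sY; apply: gateaux_eq; apply: cvg_near_cst; near=> h => /=.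
rewrite scaler0 addr0 (gateauxD_dir _ _ _ (smooth_C1 sY)).
rewrite (gateauxZ_dir _ _ _ (smooth_C1 sY)) addrC addKr scalerA mulVf ?scale1r//.
by near: h; exact: nbhs_dnbhs_neq.
Unshelve. all: by end_near. Qed.

(** Chain rule through [q |-> (q, X q)]: a second derivative of [Y], plus the first derivative of
    [Y] in the direction of the derivative of [X]. *)
Lemma gateaux_field_gateaux X Y p v : smooth X -> smooth Y ->
  gateaux (fun q => gateaux Y q (X q)) p v =
  gateaux (fun pv : V2 * V2 => gateaux Y pv.1 pv.2) (p, X p) (v, 0) +
  gateaux Y p (gateaux X p v).
Proof.
move=> sX sY; pose proof (smooth_dgateaux sY) as sD.
have sid : smooth (fun q : V2 => q) by exact: smooth_id.
transitivity (gateaux (fun pv : V2 * V2 => gateaux Y pv.1 pv.2) (p, X p)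
    (v, gateaux X p v)).
  pose proof (H := gateaux_comp p v (smooth_C1 (smooth_pair sid sX)) (smooth_C1 sD)).
  rewrite (gateaux_pair _ _ (smooth_C1 sid) (smooth_C1 sX)) gateaux_id in H.
  exact H.
rewrite -(gateaux_dgateaux_snd p (X p) (gateaux X p v) sY).
rewrite -(gateauxD_dir _ _ _ (smooth_C1 sD)); congr (gateaux _ _ _).
by congr pair; rewrite ?addr0 ?add0r.
Qed.

(** The Gauss equation: since the normal vectors at [p] are orthogonal with squared norms 1, 1, 2,
    the two terms on the right are [<II(X,X), II(Y,Y)>] and [|II(X,Y)|^2]. Tangent vectors sit in
    the base slot of [lc_normal] because only that slot gets differentiated. *)
Lemma inner2_riemann X Y p : vector_field X -> vector_field Y -> stiefel p ->
  inner2 (riemann lc_connection X Y Y p) (X p) =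
  inner2 (lc_normal (X p) (Y p) (Y p)) (X p) -
  inner2 (lc_normal (Y p) (X p) (Y p)) (X p).
Proof.
move=> vX vY sp; have tX := vX.2 p sp.
have [sX sY] := (vX.1, vY.1).
pose proof (smooth_C1 sY) as CY.
have sid : smooth (fun q : V2 => q) by exact: smooth_id.
rewrite /riemann !inner2Bl.
have E A B v : vector_field A -> vector_field B ->
    inner2 (gateaux (lc_connection A B) p v) (X p) =
    inner2 (gateaux (fun q => gateaux B q (A q)) p v) (X p) +
    inner2 (lc_normal v (A p) (B p)) (X p).
  move=> vA vB; rewrite -(gateaux_lc_normal v vA.1 vB.1 tX) -inner2Dl.
  rewrite -(gateauxD p v (smooth_C1 (smooth_gateaux_field vA.1 vB.1))
    (smooth_C1 (smooth_lc_normal sid vA.1 vB.1))).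
  exact erefl.
have perp A B : inner2 (lc_connection A B p) (X p) =
    inner2 (gateaux B p (A p)) (X p).
  rewrite /lc_connection inner2Dl -[RHS]addr0; congr (_ + _).
  exact (lc_normal_perp _ _ tX).
pose DDY u v := gateaux (fun pv : V2 * V2 => gateaux Y pv.1 pv.2) (p, u) (v, 0).
have e1 : inner2 (lc_connection X (lc_connection Y Y) p) (X p) =
    inner2 (DDY (Y p) (X p)) (X p) +
    inner2 (gateaux Y p (gateaux Y p (X p))) (X p) +
    inner2 (lc_normal (X p) (Y p) (Y p)) (X p).
  refine (etrans (perp _ _) (etrans (E Y Y (X p) vY vY) (congr1 (+%R^~ _) _))).
  exact (etrans (congr1 (fun u => inner2 u (X p)) (gateaux_field_gateaux p (X p) sY sY))
    (inner2Dl _ _ _)).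
have e2 : inner2 (lc_connection Y (lc_connection X Y) p) (X p) =
    inner2 (DDY (Y p) (X p)) (X p) +
    inner2 (gateaux Y p (gateaux X p (Y p))) (X p) +
    inner2 (lc_normal (Y p) (X p) (Y p)) (X p).
  refine (etrans (perp _ _) (etrans (E X Y (Y p) vX vY) (congr1 (+%R^~ _) _))).
  (* Symmetry brings the second derivative into the form it has in [e1], so the two cancel. *)
  rewrite /DDY -(gateaux_schwarz CY (smooth_C1 (smooth_dgateaux sY)) p (X p) (Y p)).
  exact (etrans (congr1 (fun u => inner2 u (X p)) (gateaux_field_gateaux p (Y p) sX sY))
    (inner2Dl _ _ _)).
have e3 : inner2 (lc_connection (lie_bracket X Y) Y p) (X p) =
    inner2 (gateaux Y p (gateaux Y p (X p))) (X p) -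
    inner2 (gateaux Y p (gateaux X p (Y p))) (X p).
  by rewrite perp /lie_bracket (gateauxB_dir _ _ _ CY) inner2Bl.
have cancel (x1 x2 x3 x4 x5 : R) :
  (x1 + x2 + x3) - (x1 + x4 + x5) - (x2 - x4) = x3 - x5 by ring.
exact (etrans (f_equal2 (fun x y : R => x - y)
  (f_equal2 (fun x y : R => x - y) e1 e2) e3) (cancel _ _ _ _ _)).
Qed.

Lemma sectional_curvature_stiefel p xi eta (k : R) : stiefel p ->
  tangent p xi -> tangent p eta ->
  (inner2 (lc_normal xi eta eta) xi - inner2 (lc_normal eta xi eta) xi) /
    (inner2 xi xi * inner2 eta eta - inner2 xi eta ^+ 2) = k ->
  is_sectional_curvature p xi eta k.
Proof.
move=> sp tx te <-; split.
- by exists lc_connection; exact: lc_connection_is_levi_civita.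
- exists (proj_field xi), (proj_field eta).
  split; [exact: vector_field_proj|exact: vector_field_proj|
    exact: proj_field_eq|exact: proj_field_eq].
- move=> nabla X Y LN vX vY Xp Yp; congr (_ / _).
  rewrite (riemann_unique LN lc_connection_is_levi_civita vX vY vY sp).
  have := inner2_riemann vX vY sp; rewrite Xp Yp => ->.
  exact erefl.
Qed.

End levi_civita.

(** * Hilbert-Schmidt norm of a sum of two wedge products *)

Section hilbert_schmidt.
Context {R : realType} {b : bool}.
Local Notation V := (V R b).
Implicit Types (f g h k : V).

Lemma normV_sqr f : normV f ^+ 2 = inner f f.
Proof. by rewrite sqr_sqrtr// inner_ge0. Qed.

Lemma hs_norm_sqr (S : R -> R -> R) : hs_norm S ^+ 2 = hs_inner S S.
Proof.
rewrite sqr_sqrtr//; apply: Rintegral_ge0 => x _; apply: Rintegral_ge0 => y _.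
by rewrite -expr2 sqr_ge0.
Qed.

Lemma hs_inner_wedge2 f g h k :
  let T := tensor f g - tensor g f + tensor h k - tensor k h in
  hs_inner T T = 2 * (inner f f * inner g g - inner f g ^+ 2 +
    inner h h * inner k k - inner h k ^+ 2) +
    4 * (inner f h * inner g k - inner f k * inner g h).
Proof.
move=> T.
have integrable2 (u v w z : V) : lebesgue_measure.-integrable `[0, 2 * pi]
    (EFin \o (fun x => u x * v x + w x * z x)).
  apply: continuous_compact_integrable; first exact: segment_compact.
  apply: continuous_subspaceT => x.
  apply: (@continuousD _ _ _ (fun x : R => u x * v x) (fun x : R => w x * z x)).
  - apply: continuousM; first exact: (@V_continuous R b u 0).
    exact: (@V_continuous R b v 0).
  - apply: continuousM; first exact: (@V_continuous R b w 0).
    exact: (@V_continuous R b z 0).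
(* For fixed [x] the kernel is an element of [V] in its second variable, so the inner integral is
   [inner (W x) (W x)], a quadratic form in the values of [f], [g], [h], [k] at [x]. *)
pose W x : V := f x *: g - g x *: f + h x *: k - k x *: h.
have TE x y : T x y = W x y.
  have -> : T x y = f x * g y - g x * f y + h x * k y - k x * h y by [].
  by rewrite /W !(VfunD, VfunN, VfunZ).
(* Half the partial derivatives of that quadratic form: it equals [f x * F x + g x * G x + h x * H x
   + k x * K x], each mixed term being shared evenly by its two factors. *)
pose F : V := inner g g *: f - inner f g *: g + inner g k *: h - inner g h *: k.
pose G : V := inner f f *: g - inner f g *: f + inner f h *: k - inner f k *: h.
pose H : V := inner k k *: h - inner h k *: k + inner g k *: f - inner f k *: g.
pose K : V := inner h h *: k - inner h k *: h + inner f h *: g - inner g h *: f.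
have -> : hs_inner T T = inner f F + inner g G + (inner h H + inner k K).
  rewrite /inner -!RintegralD//;
    [|by first [exact: inner_integrable|exact: integrable2]..].
  apply: eq_Rintegral => x _.
  transitivity (inner (W x) (W x)).
    by apply: eq_Rintegral => y _; rewrite !TE.
  rewrite /W /F /G /H /K !(VfunD, VfunN, VfunZ) !innerE.
  rewrite (innerC g f) (innerC h f) (innerC h g) (innerC k f) (innerC k g)
    (innerC k h).
  by ring.
rewrite /F /G /H /K !innerE.
rewrite (innerC g f) (innerC h f) (innerC h g) (innerC k f) (innerC k g)
    (innerC k h).
by ring.
Qed.

End hilbert_schmidt.

Theorem mainTheorem4 (R : realType) (b : bool)
    (e f de1 df1 de2 df2 : V R b) :
  stiefel (e, f) ->
  tangent (e, f) (de1, df1) ->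
  tangent (e, f) (de2, df2) ->
  inner2 (de1, df1) (de1, df1) = 1 ->
  inner2 (de2, df2) (de2, df2) = 1 ->
  inner2 (de1, df1) (de2, df2) = 0 ->
  let K := normV de1 ^+ 2 * normV de2 ^+ 2 + normV df1 ^+ 2 * normV df2 ^+ 2
    + 2 * inner de1 df1 * inner de2 df2
    - inner de1 de2 ^+ 2 - inner df1 df2 ^+ 2
    - 2^-1 * (inner de1 df2 + inner df1 de2) ^+ 2 in
  is_sectional_curvature (e, f) (de1, df1) (de2, df2) K /\
  K = 2^-1 * hs_norm (tensor de1 de2 - tensor de2 de1
                      + tensor df1 df2 - tensor df2 df1) ^+ 2
      - 2^-1 * (inner de1 df2 - inner de2 df1) ^+ 2.
Proof.
move=> sp t1 t2 n1 n2 n12 K.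
have KE : K = inner de1 de1 * inner de2 de2 + inner df1 df1 * inner df2 df2
    + 2 * inner de1 df1 * inner de2 df2
    - inner de1 de2 ^+ 2 - inner df1 df2 ^+ 2
    - 2^-1 * (inner de1 df2 + inner df1 de2) ^+ 2 by rewrite /K !normV_sqr.
rewrite KE; split.
  apply: sectional_curvature_stiefel => //.
  (* Orthonormality turns the Gram determinant in the denominator into 1. *)
  rewrite n1 n2 n12 !inner2_lc_normal /=.
  rewrite (innerC df2 de2) (innerC df1 de1) (innerC de2 de1) (innerC df2 df1).
  rewrite (innerC de2 df1) (innerC df2 de1).
  by field.
(* With [x = inner de1 df2] and [y = inner df1 de2], the mixed terms match because
   [- 2xy - (x - y)^2 / 2 = - (x + y)^2 / 2]. *)
rewrite hs_norm_sqr hs_inner_wedge2 (innerC de2 df1).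
by field.
Qed.
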